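(* Let $n$ be a positive integer and let $q=p^r \equiv 1 \pmod n$ be an odd prime power. Let $\zeta_n$ be a primitive $n$-th root of unity in $\mathbb{F}_q^{*}$. Let $\lambda\in\mathbb{F}_q$, $m\in\mathbb{Z}^+$ and $a_1,\dots,a_m,b_1,\dots,b_m\in\mathbb{Q}\cap\mathbb{Z}_p$. If $(\{na_i\}, \{nb_i\})$ are defined over $\mathbb{Q}$, then $$\sum_{l=0}^{n-1} {}_{m}G_{m}\left[ \begin{array}{cccc} n a_1, & n a_2, & \dots, & n a_m \\ n b_1, & n b_2, & \dots, & n b_m \end{array} \Big| \; \zeta_n^l \cdot\lambda \right]_q = {}_{nm}G_{nm}\left[ \begin{array}{c} a_i+\frac{l}{n} : 1 \leq i \leq m,\ 0 \leq l \leq n-1 \\ b_i +\frac{l}{n} : 1 \leq i \leq m,\ 0 \leq l \leq n-1 \end{array} \Big| \; \lambda^n \right]_q.$$ Furthermore, if $(\{na_i\}, \{nb_i\})$ are defined over $\mathbb{Q}$ with corresponding exponents $(\{p_i : 1 \leq i \leq t \}, \{q_i : 1 \leq i \leq s \})$, then $(\{a_i+\frac{l}{n}\}, \{b_i+\frac{l}{n}\})$ (with $1\le i\le m$, $0\le l\le n-1$) are defined over $\mathbb{Q}$ with exponents $(\{n p_i : 1 \leq i \leq t \}, \{n q_i : 1 \leq i \leq s\})$.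
   Context: $\mathbb{Z}_p$ is the ring of $p$-adic integers and $\Gamma_p$ is Morita's $p$-adic gamma function: $\Gamma_p(n):=(-1)^n\prod_{0<j<n,\,p\nmid j}j$ for $n\in\mathbb{Z}^+$, extended continuously to $\mathbb{Z}_p$, with $\Gamma_p(0)=1$. $\omega:\mathbb{F}_q^*\to\mathbb{Z}_q^{\times}$ is the Teichmüller character ($\mathbb{Z}_q$ the ring of integers of the unramified extension of $\mathbb{Q}_p$ with residue field $\mathbb{F}_q$; $\omega(x)$ is the $(q-1)$-st root of unity congruent to $x$ mod $p$), $\overline{\omega}$ is its inverse, and all powers (including the trivial one) are extended by the value $0$ at $0\in\mathbb{F}_q$. For $x\in\mathbb{Q}$, $\lfloor x\rfloor$ is the greatest integer less than or equal to $x$ and $\langle x\rangle=x-\lfloor x\rfloor$. Definition of ${}_mG_m$: for $q=p^r$, $p$ an odd prime, $\lambda\in\mathbb{F}_q$, $m\in\mathbb{Z}^+$, $a_i,b_i\in\mathbb{Q}\cap\mathbb{Z}_p$ ($1\le i\le m$), $${}_{m}G_{m}\left[ \begin{array}{ccc} a_1, & \dots, & a_m \\ b_1, & \dots, & b_m \end{array} \Big| \; \lambda \right]_q := \frac{-1}{q-1} \sum_{j=0}^{q-2} (-1)^{jm}\, \overline{\omega}^j(\lambda) \prod_{i=1}^{m} \prod_{k=0}^{r-1} \frac{\Gamma_p(\langle (a_i -\frac{j}{q-1} )p^k \rangle)}{\Gamma_p(\langle a_i p^k \rangle)} \frac{\Gamma_p(\langle (-b_i +\frac{j}{q-1}) p^k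 \rangle)}{\Gamma_p(\langle -b_i p^k\rangle)} (-p)^{-\lfloor\langle a_i p^k \rangle -\frac{j p^k}{q-1}\rfloor -\lfloor\langle -b_i p^k\rangle +\frac{j p^k}{q-1}\rfloor}.$$ Parameters defined over $\mathbb{Q}$: parameters $(\{\alpha_i\}_{i=1}^{m},\{\beta_i\}_{i=1}^{m})$ are defined over $\mathbb{Q}$ if there exist positive integers $p_1,\dots,p_t$ and $q_1,\dots,q_s$ (the corresponding exponents), with $t$ and $s$ minimal, such that $$\prod_{i=1}^{m} \frac{x- e^{2 \pi \mathrm{i} \alpha_i}}{x- e^{2 \pi \mathrm{i} \beta_i}} = \frac{\prod_{i=1}^{t} (x^{p_i} - 1)}{\prod_{i=1}^{s} (x^{q_i} - 1)}.$$ *)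

(* Defs.v *)
From HB Require Import structures.
From mathcomp Require Import all_boot all_order all_algebra all_field.
From mathcomp Require Import boolp classical_sets reals trigo.
From mathcomp Require Import complex.

Set Implicit Arguments.
Unset Strict Implicit.
Unset Printing Implicit Defensive.

Import Order.TTheory GRing.Theory Num.Theory.
Local Open Scope ring_scope.

(* Z_p is the inverse limit of the rings Z / p^n: [x n] is the representative
   of x mod p^n in [0, p^n). *)
Record padic_int (p : nat) (p_pr : prime p) := PadicInt {
  residue :> nat -> nat;
  residueP : forall n, residue n = (residue n.+1 %% p ^ n)%N }.

Section PadicIntegers.
Variables (p : nat) (p_pr : prime p).
Local Notation Zp := (padic_int p_pr).

HB.instance Definition _ := gen_eqMixin Zp.
HB.instance Definition _ := gen_choiceMixin Zp.

Lemma padic_intP (x y : Zp) : (forall n, x n = y n) -> x = y.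
Proof.
case: x y => [x xP] [y yP] /= /funext exy; subst y.
by congr PadicInt; apply: Prop_irrelevance.
Qed.

Fact padic_expn_gt0 n : (0 < p ^ n)%N.
Proof. by rewrite expn_gt0 prime_gt0. Qed.

Lemma residue_mod (x : Zp) n : (x n %% p ^ n = x n)%N.
Proof. by rewrite residueP modn_mod. Qed.

Lemma residue_lt (x : Zp) n : (x n < p ^ n)%N.
Proof. by rewrite residueP ltn_mod padic_expn_gt0. Qed.

Lemma modn_expS a n : (a %% p ^ n.+1 = a %[mod p ^ n])%N.
Proof. by rewrite modn_dvdm // dvdn_exp2l. Qed.

Lemma residue_le (x : Zp) m n : (m <= n)%N -> x m = (x n %% p ^ m)%N.
Proof.
elim: n => [|n IHn]; first by rewrite leqn0 => /eqP->; rewrite residue_mod.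
rewrite leq_eqVlt => /predU1P[->|lemn]; first by rewrite residue_mod.
by rewrite IHn // residueP modn_dvdm // dvdn_exp2l.
Qed.

Fact mkpadic_subproof (f : nat -> nat) :
  (forall n, f n.+1 = f n %[mod p ^ n])%N ->
  forall n, (f n %% p ^ n = (f n.+1 %% p ^ n.+1) %% p ^ n)%N.
Proof. by move=> fP n; rewrite modn_expS fP. Qed.

Definition mkpadic f fP : Zp := PadicInt p_pr (@mkpadic_subproof f fP).

Fact padic_nat_subproof (a : nat) n : (a = a %[mod p ^ n])%N.
Proof. by []. Qed.

Definition padic_of_nat a : Zp := mkpadic (padic_nat_subproof a).

Fact padic_add_subproof (x y : Zp) n :
  (x n.+1 + y n.+1 = x n + y n %[mod p ^ n])%N.
Proof. by rewrite (residueP x n) (residueP y n) modnDm. Qed.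

Definition padic_add x y := mkpadic (padic_add_subproof x y).

Fact padic_mul_subproof (x y : Zp) n :
  (x n.+1 * y n.+1 = x n * y n %[mod p ^ n])%N.
Proof. by rewrite (residueP x n) (residueP y n) modnMm. Qed.

Definition padic_mul x y := mkpadic (padic_mul_subproof x y).

Fact padic_opp_subproof (x : Zp) n :
  (p ^ n.+1 - x n.+1 = p ^ n - x n %[mod p ^ n])%N.
Proof.
apply/eqP; rewrite -(eqn_modDr (x n.+1)) subnK ?(ltnW (residue_lt _ _)) //.
rewrite -modnDmr -residueP subnK ?(ltnW (residue_lt _ _)) // modnn.
by apply/eqP/eqP; rewrite expnS modnMl.
Qed.

Definition padic_opp x := mkpadic (padic_opp_subproof x).

Fact padic_addA : associative padic_add.
Proof. by move=> x y z; apply: padic_intP => n /=; rewrite modnDmr modnDml addnA. Qed.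

Fact padic_addC : commutative padic_add.
Proof. by move=> x y; apply: padic_intP => n /=; rewrite addnC. Qed.

Fact padic_add0 : left_id (padic_of_nat 0) padic_add.
Proof. by move=> x; apply: padic_intP => n /=; rewrite mod0n add0n residue_mod. Qed.

Fact padic_addN : left_inverse (padic_of_nat 0) padic_opp padic_add.
Proof.
move=> x; apply: padic_intP => n /=.
by rewrite modnDml subnK ?(ltnW (residue_lt _ _)) // modnn mod0n.
Qed.

HB.instance Definition _ :=
  GRing.isZmodule.Build Zp padic_addA padic_addC padic_add0 padic_addN.

Fact padic_mulA : associative padic_mul.
Proof. by move=> x y z; apply: padic_intP => n /=; rewrite modnMmr modnMml mulnA. Qed.

Fact padic_mulC : commutative padic_mul.
Proof. by move=> x y; apply: padic_intP => n /=; rewrite mulnC. Qed.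

Fact padic_mul1 : left_id (padic_of_nat 1) padic_mul.
Proof. by move=> x; apply: padic_intP => n /=; rewrite modnMml mul1n residue_mod. Qed.

Fact padic_mulD : left_distributive padic_mul padic_add.
Proof.
by move=> x y z; apply: padic_intP => n /=; rewrite modnMml modnDm mulnDl.
Qed.

Fact padic_1neq0 : padic_of_nat 1 != 0.
Proof.
apply/eqP => /(congr1 (fun x : Zp => x 1%N)) /=.
by rewrite expn1 modn_small ?prime_gt1 // mod0n.
Qed.

HB.instance Definition _ := GRing.Zmodule_isComNzRing.Build Zp
  padic_mulA padic_mulC padic_mul1 padic_mulD padic_1neq0.

Definition padic_unit : {pred Zp} := fun x => `[< exists y : Zp, y * x = 1 >].

Definition padic_inv (x : Zp) : Zp :=
  if pselect (exists y : Zp, y * x = 1) is left e then projT1 (cid e) else x.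

Fact padic_mulVr : {in padic_unit, left_inverse 1 padic_inv *%R}.
Proof.
move=> x /asboolP ux; rewrite /padic_inv.
by case: pselect => // e; case: (cid e).
Qed.

Fact padic_unitP (x y : Zp) : y * x = 1 -> padic_unit x.
Proof. by move=> yx1; apply/asboolP; exists y. Qed.

Fact padic_inv_out : {in [predC padic_unit], padic_inv =1 id}.
Proof.
move=> x /asboolPn nux; rewrite /padic_inv.
by case: pselect.
Qed.

HB.instance Definition _ := GRing.ComNzRing_hasMulInverse.Build Zp
  padic_mulVr padic_unitP padic_inv_out.

Fact padic_idomain : GRing.integral_domain_axiom Zp.
Proof.
move=> x y xy0; apply/norP => -[x0 y0].
have nz (z : Zp) : z != 0 -> exists n, ~~ (p ^ n %| z n)%N.
  move=> z0; apply/not_existsP => zP; case/eqP: z0.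
  apply: padic_intP => n /=; rewrite mod0n -(residue_mod z n).
  by apply/eqP; have /negP := zP n; rewrite negbK.
have [m xm] := nz _ x0; have [n yn] := nz _ y0.
pose k := (m + n)%N.
have xk : ~~ (p ^ m %| x k)%N.
  by apply: contra xm; rewrite (residue_le x (leq_addr n m)) -/k /dvdn modn_mod.
have yk : ~~ (p ^ n %| y k)%N.
  by apply: contra yn; rewrite (residue_le y (leq_addl m n)) -/k /dvdn modn_mod.
have gt0 a b : ~~ (p ^ a %| b)%N -> (0 < b)%N by case: b => //; rewrite dvdn0.
have lt_log a b : ~~ (p ^ a %| b)%N -> (logn p b < a)%N.
  by move=> ab; rewrite ltnNge -pfactor_dvdn // (gt0 _ _ ab).
move: (congr1 (fun z : Zp => z k) xy0) => /= /eqP.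
rewrite mod0n -/(dvdn _ _) pfactor_dvdn // ?muln_gt0 ?(gt0 _ _ xk) ?(gt0 _ _ yk) //.
rewrite lognM ?(gt0 _ _ xk) ?(gt0 _ _ yk) // leqNgt => /negP; apply.
by rewrite /k -addSn leq_add ?lt_log // ltnW ?lt_log.
Qed.

HB.instance Definition _ :=
  GRing.ComUnitRing_isIntegral.Build Zp padic_idomain.

(* Cofinality of the p^n makes this continuity for the p-adic topology:
   [x n = y n] says x = y mod p^n. *)
Definition padic_continuous (f : Zp -> Zp) : Prop :=
  forall (x : Zp) n, exists m, forall y : Zp, y m = x m -> f y n = f x n.

Definition morita_gamma_spec (g : Zp -> Zp) : Prop :=
  [/\ padic_continuous g, g 0 = 1 &
      forall n, (0 < n)%N ->
        g n%:R = (-1) ^+ n * \prod_(1 <= j < n | ~~ (p %| j)%N) j%:R].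

(* Z^+ being dense in Z_p, at most one function satisfies the specification;
   one does for p odd. *)
Definition padic_gamma : Zp -> Zp :=
  xget (fun=> 0) [set g | morita_gamma_spec g]%classic.

End PadicIntegers.

Notation "''Qp' p_pr" := {fraction (padic_int p_pr)}
  (at level 8, p_pr at level 2, format "''Qp'  p_pr").

(* Rationals in Z_p; then [ratr a : padic_int p_pr] is a, as the denominator
   is invertible. *)
Definition padic_integral (p : nat) (a : rat) : Prop := coprime p `|denq a|%N.

Definition fracpart (x : rat) : rat := x - (Num.floor x)%:~R.

Section Hypergeometric.
Variables (p : nat) (p_pr : prime p).
Local Notation Zp := (padic_int p_pr).
Local Notation Qp := ('Qp p_pr).
Variables (F : finFieldType) (L : fieldExtType Qp).

Definition integer_of_ext (x : L) : Prop :=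
  integralOver (in_alg L \o @tofrac Zp) x.

(* L is the unramified extension of Q_p with residue field F: res restricts to
   a surjective ring morphism from the ring of integers of L to F, whose kernel
   is generated by p. Its values outside of the ring of integers are junk. *)
Definition unramified_residue (res : L -> F) : Prop :=
  [/\ res 1 = 1,
      forall x y, integer_of_ext x -> integer_of_ext y ->
        res (x + y) = res x + res y /\ res (x * y) = res x * res y,
      forall c, exists2 x, integer_of_ext x & res x = c &
      forall x, integer_of_ext x ->
        (res x = 0 <-> exists2 y, integer_of_ext y & x = p%:R * y)].

Variable res : L -> F.

Definition teichmuller (x : F) : L :=
  if x == 0 then 0 else
  xget 0 [set z | z ^+ #|F|.-1 = 1 /\ res z = x]%classic.

(* The j-th power of the inverse of the Teichmuller character, which takes the
   value 0 at 0 even if j = 0. *)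
Definition teichmuller_bar_exp (j : nat) (x : F) : L :=
  if x == 0 then 0 else (teichmuller x)^-1 ^+ j.

(* The value of the p-adic gamma function at a rational in Z_p. *)
Definition gamma_rat (x : rat) : Qp := tofrac (padic_gamma (ratr x : Zp)).

(* The parameters are indexed by a finite type I with m elements. *)
Definition mGm (I : finType) (a b : I -> rat) (r : nat) (lambda : F) : L :=
  let q := (p ^ r)%N in
  let c (j : nat) : rat := j%:R / (q - 1)%:R in
  ((- 1) / (q - 1)%:R : Qp) *:
  \sum_(j < q.-1)
    ((-1) ^+ (j * #|I|) *
     \prod_(i : I) \prod_(k < r)
       (gamma_rat (fracpart ((a i - c j) * p%:R ^+ k))
          / gamma_rat (fracpart (a i * p%:R ^+ k))
        * (gamma_rat (fracpart ((- b i + c j) * p%:R ^+ k))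
          / gamma_rat (fracpart (- b i * p%:R ^+ k)))
        * (- p%:R) ^ (- Num.floor (fracpart (a i * p%:R ^+ k)
                                   - c j * p%:R ^+ k)
                      - Num.floor (fracpart (- b i * p%:R ^+ k)
                                   + c j * p%:R ^+ k))) : Qp)
    *: teichmuller_bar_exp j lambda.

End Hypergeometric.

Section DefinedOverQ.
Variable R : realType.

Definition exp2pii (x : rat) : R[i] :=
  (cos (2 * pi * ratr x) +i* sin (2 * pi * ratr x))%C.

Definition exponents_eq (I : finType) (alpha beta : I -> rat) (P Q : seq nat)
    : Prop :=
  [/\ all (ltn 0) P, all (ltn 0) Q &
      \prod_(i : I) (tofrac ('X - (exp2pii (alpha i))%:P)
                     / tofrac ('X - (exp2pii (beta i))%:P))
      = tofrac (\prod_(k <- P) ('X^k - 1)) / tofrac (\prod_(k <- Q) ('X^k - 1))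
      :> {fraction {poly R[i]}}].

(* P = (p_1, ..., p_t) and Q = (q_1, ..., q_s), with t and s minimal. *)
Definition defined_over_Q_with (I : finType) (alpha beta : I -> rat)
    (P Q : seq nat) : Prop :=
  exponents_eq alpha beta P Q /\
  forall P' Q', exponents_eq alpha beta P' Q' ->
    (size P <= size P')%N /\ (size Q <= size Q')%N.

Definition defined_over_Q (I : finType) (alpha beta : I -> rat) : Prop :=
  exists P Q, defined_over_Q_with alpha beta P Q.

End DefinedOverQ.

(* Main.v *)
Require Import Defs.
From HB Require Import structures.
From mathcomp Require Import all_boot all_order all_algebra all_field.
From mathcomp Require Import boolp classical_sets reals trigo.
From mathcomp Require Import cyclic complex.
From mathcomp Require Import ring lra zify.

(** Summing over the n-th roots of unity kills all the terms of the n series on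
    the left but those of index n j, so it suffices to match the coefficient of
    index j for the parameters a + l/n, b + l/n with the coefficient of index
    n j for n a, n b; the latter is periodic in n j modulo q - 1.

    The n-th parts modulo 1 of n a p^k are the (a + l/n) p^k, so the exponents
    of -p agree by Hermite's identity, and Gamma_p is governed by the
    multiplication formula
      prod_(h < n) Gamma_p((-K + h)/n) = c n^(K - K %/ p) Gamma_p(-K)
    at the negative integers, which are dense in Z_p. For a rational z in
    [0, 1) with (p^N - 1) z an integer, and Q = p^(N M), the integer
    -z (Q - 1) approximates z modulo Q, and its exponent is
      (z - z') (Q - 1) + (p z' - z) Q/p   where z' = <p^(N-1) z>.
    So if the sums T of the z and T' of the z', counted with signs, are the same
    integer, the total exponent is T phi(Q) and the powers of n cancel modulo Q.
    T - T' telescopes in k to the variation of a sum over the a and b under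
    multiplication by p^r, which vanishes because modulo 1 the a minus the b are
    a combination of full groups (1/k)Z/Z: this is where being defined over Q
    is used.

    The exponents part rests on the multiplicative independence of the X^k - 1
    and on the disjointness of the exponents in a minimal representation. *)

Set Implicit Arguments.
Unset Strict Implicit.
Unset Printing Implicit Defensive.

Import Order.TTheory GRing.Theory Num.Theory.
Local Open Scope ring_scope.

(** * Fractional parts *)

Section FractionalPart.

Lemma fracpart_itv x : 0 <= fracpart x < 1.
Proof.
by have := floor_itv x; rewrite /fracpart intrD => /andP[? ?]; apply/andP; lra.
Qed.

Lemma fracpart_subr_int x : fracpart x - x \is a Num.int.
Proof. by rewrite /fracpart addrAC subrr add0r rpredN intr_int. Qed.

Lemma subr_int_eq x y : 0 <= x < 1 -> 0 <= y < 1 ->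
  x - y \is a Num.int -> x = y :> rat.
Proof.
move=> /andP[x0 x1] /andP[y0 y1] /intrP[k xyk].
have : ((-1)%:~R < (k%:~R : rat)) by rewrite -xyk; lra.
have : (k%:~R : rat) < 1%:~R by rewrite -xyk; lra.
rewrite !ltr_int => k1 k0; suff k_0 : k = 0 by rewrite k_0 in xyk; lra.
lia.
Qed.

Lemma fracpart_eq x y : x - y \is a Num.int -> fracpart x = fracpart y.
Proof.
move=> xy; apply: subr_int_eq; rewrite ?fracpart_itv //.
have -> : fracpart x - fracpart y
  = (fracpart x - x) - (fracpart y - y) + (x - y) by ring.
by rewrite rpredD // rpredB // fracpart_subr_int.
Qed.

Lemma fracpart_inj x y : fracpart x = fracpart y -> x - y \is a Num.int.
Proof.
move=> xy.
have -> : x - y = (fracpart y - y) - (fracpart x - x) by rewrite xy; ring.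
by rewrite rpredB // fracpart_subr_int.
Qed.

Lemma fracpart_id x : 0 <= x < 1 -> fracpart x = x.
Proof.
by move=> x01; apply: subr_int_eq; rewrite ?fracpart_itv ?fracpart_subr_int.
Qed.

Lemma fracpart_fracpartMD (k : int) x y :
  fracpart (k%:~R * fracpart x + y) = fracpart (k%:~R * x + y).
Proof.
apply: fracpart_eq.
have -> : k%:~R * fracpart x + y - (k%:~R * x + y) = k%:~R * (fracpart x - x).
  by ring.
by rewrite rpredM ?intr_int ?fracpart_subr_int.
Qed.

Lemma fracpartN x :
  fracpart (- x) = (x \isn't a Num.int)%:R - fracpart x.
Proof.
apply: subr_int_eq; rewrite ?fracpart_itv //.
  have := fracpart_itv x; have [xint|xNint] /= := boolP (x \is a Num.int).
    suff -> : fracpart x = 0 by [].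
    have -> : fracpart x = fracpart 0 by apply: fracpart_eq; rewrite subr0.
    by rewrite fracpart_id.
  suff : fracpart x != 0 by move=> x0 /andP[? ?]; apply/andP; split; lra.
  apply: contraNneq xNint => x0; have := fracpart_subr_int x.
  by rewrite x0 sub0r rpredN.
have -> : fracpart (- x) - ((x \isn't a Num.int)%:R - fracpart x)
   = (fracpart (- x) - (- x)) + (fracpart x - x) - (x \isn't a Num.int)%:R.
  by ring.
by rewrite rpredB ?natr_int // rpredD ?fracpart_subr_int.
Qed.

(* With n coprime to s, the n numbers x + l s / n are, modulo 1, the n-th
   parts of n x. *)
Lemma big_fracpart_shift (T : Type) (idx : T) (op : Monoid.com_law idx)
    (f : rat -> T) (x : rat) (n : nat) (s : int) :
  (0 < n)%N -> coprimez n s ->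
  \big[op/idx]_(l < n) f (fracpart (x + l%:R / n%:R * s%:~R)) =
  \big[op/idx]_(h < n) f ((fracpart (n%:R * x) + h%:R) / n%:R).
Proof.
move=> n_gt0 co_ns.
have n_neq0 : n%:R != 0 :> rat by rewrite pnatr_eq0 -lt0n.
have nR_gt0 : 0 < n%:R :> rat by rewrite ltr0n.
pose y (l : 'I_n) := fracpart (x + l%:R / n%:R * s%:~R).
(* Modulo 1, n y_l is n x, so the integer part of n y_l is the index h in [0, n) matched to l. *)
pose g (l : 'I_n) := `|Num.floor (n%:R * y l)|%N.
have y_itv l : 0 <= y l < 1 by apply: fracpart_itv.
have gE l : (g l)%:R = n%:R * y l - fracpart (n%:R * x).
  have -> : (g l)%:R = (Num.floor (n%:R * y l))%:~R :> rat.
    rewrite pmulrn /g gez0_abs // floor_ge0 mulr_ge0 ?ler0n //.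
    by case/andP: (y_itv l).
  have -> : fracpart (n%:R * x) = fracpart (n%:R * y l).
    rewrite -[n%:R * y l]addr0 pmulrn fracpart_fracpartMD -pmulrn.
    apply: fracpart_eq.
    have -> : n%:R * x - (n%:R * (x + l%:R / n%:R * s%:~R) + 0)
        = - (l%:R * s%:~R) by field.
    by rewrite rpredN rpredM ?natr_int ?intr_int.
  by rewrite /fracpart; ring.
have g_lt l : (g l < n)%N.
  rewrite -(ltr_nat rat) gE; have /andP[fr0 _] := fracpart_itv (n%:R * x).
  have : n%:R * y l < n%:R * 1 by rewrite ltr_pM2l //; case/andP: (y_itv l).
  by lra.
pose G l := Ordinal (g_lt l).
(* Equal images give equal y, so n divides (l1 - l2) s, hence l1 - l2. On a finite set injectivity
   is enough for reindexing. *)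
have G_inj : injective G.
  move=> l1 l2 /(congr1 val) /= g12.
  have /(mulfI n_neq0) y12 : n%:R * y l1 = n%:R * y l2.
    by have := gE l1; have := gE l2; rewrite g12; lra.
  have /intrP[k] := fracpart_inj y12.
  have -> : x + l1%:R / n%:R * s%:~R - (x + l2%:R / n%:R * s%:~R)
       = (l1%:R - l2%:R) * s%:~R / n%:R by field.
  move/(congr1 ( *%R^~ n%:R)); rewrite divfK // => Ek.
  have {}Ek : ((l1 : int) - (l2 : int)) * s = k * n.
    by apply/eqP; rewrite -(eqr_int rat) !rmorphM rmorphB /= -!pmulrn Ek.
  have dvd : (n %| (l1 : int) - (l2 : int))%Z.
    by rewrite -(Gauss_dvdzl _ co_ns) Ek dvdz_mull.
  apply: val_inj => /=; move: dvd; rewrite dvdzE.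
  have := ltn_ord l1; have := ltn_ord l2 => lt2 lt1.
  have [/eqP|gt0] := posnP `|(l1 : int) - (l2 : int)|; first by lia.
  by move/(dvdn_leq gt0); lia.
rewrite [RHS](reindex_inj G_inj); apply: eq_bigr => l _.
by congr f; rewrite gE -/(y l); field.
Qed.

(** Hermite's identity. Each floor is its argument minus a fractional part; [big_fracpart_shift]
    with s = 1 handles the fractional parts, and a sum of n equal terms remains. *)
Lemma sum_floor_shift (x t : rat) (n : nat) : (0 < n)%N ->
  \sum_(h < n) Num.floor ((x + h%:R) / n%:R - t) = Num.floor (x - n%:R * t).
Proof.
move=> n_gt0; have n_neq0 : n%:R != 0 :> rat by rewrite pnatr_eq0 -lt0n.
apply/eqP; rewrite -(eqr_int rat) rmorph_sum /=.
pose u := x / n%:R - t.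
have fl z : (Num.floor z)%:~R = z - fracpart z by rewrite /fracpart; ring.
have -> : \sum_(h < n) (Num.floor ((x + h%:R) / n%:R - t))%:~R
    = \sum_(h < n) ((u + h%:R / n%:R) - fracpart (u + h%:R / n%:R * 1%:~R)).
  apply: eq_bigr => h _; rewrite fl mulr1.
  by have -> : (x + h%:R) / n%:R - t = u + h%:R / n%:R by rewrite /u; field.
have co1 : coprimez n 1 by rewrite coprimezE /= coprimen1.
rewrite sumrB (big_fracpart_shift _ id _ n_gt0 co1).
have -> : x - n%:R * t = n%:R * u by rewrite /u; field.
rewrite fl -sumrB.
under eq_bigr => h _.
  have -> : u + h%:R / n%:R - (fracpart (n%:R * u) + h%:R) / n%:R
     = (n%:R * u - fracpart (n%:R * u)) / n%:R by field.
  over.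
by rewrite sumr_const card_ord -(mulr_natr (_ / _)) divfK.
Qed.

End FractionalPart.

(** * Exponents of parameters defined over Q *)

Section RootsOfUnity.
Variable R : realType.
Local Notation e := (exp2pii R).

Lemma exp2piiD x y : e (x + y) = e x * e y.
Proof.
rewrite /exp2pii rmorphD mulrDr cosD sinD.
by apply/eqP; rewrite eq_complex /= eqxx /= addrC eqxx.
Qed.

Lemma exp2pii0 : e 0 = 1.
Proof. by rewrite /exp2pii rmorph0 mulr0 cos0 sin0. Qed.

Lemma exp2pii1 : e 1 = 1.
Proof. by rewrite /exp2pii rmorph1 mulr1 mulr_natl cos2pi sin2pi. Qed.

Lemma exp2pii_neq0 x : e x != 0.
Proof.
have : e x * e (- x) != 0 by rewrite -exp2piiD subrr exp2pii0 oner_neq0.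
by rewrite mulf_eq0 => /norP[].
Qed.

Lemma exp2piiMn k x : e (k%:R * x) = e x ^+ k.
Proof.
elim: k => [|k IHk]; first by rewrite mul0r exp2pii0 expr0.
by rewrite -addn1 natrD mulrDl mul1r exp2piiD IHk addn1 exprSr.
Qed.

Lemma exp2pii_int x : x \is a Num.int -> e x = 1.
Proof.
have nat1 k : e k%:R = 1 by rewrite -[k%:R]mulr1 exp2piiMn exp2pii1 expr1n.
case/intrP => -[k|k] ->; first by rewrite -pmulrn nat1.
apply: (mulIf (exp2pii_neq0 k.+1%:R)).
by rewrite -exp2piiD NegzE mulrNz -pmulrn addNr exp2pii0 nat1 mulr1.
Qed.

Lemma exp2pii_eq1 x : (e x == 1) = (x \is a Num.int).
Proof.
apply/eqP/idP => [ex1|]; last exact: exp2pii_int.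
have : e (fracpart x) = 1.
  rewrite -[fracpart x](subrK x) exp2piiD ex1 mulr1.
  exact/exp2pii_int/fracpart_subr_int.
(* By duplication, cos (2 t) = 1 forces sin t = 0, whereas t = pi <x> lies strictly between 0 and pi
   unless <x> = 0. *)
rewrite /exp2pii -mulrA mulr_natl cos_mulr2n => -[cos1 _].
have /andP[fr_ge0 fr_lt1] := fracpart_itv x.
suff : fracpart x = 0 by move=> /eqP; rewrite subr_eq0 => /eqP->; apply: intr_int.
apply/eqP; rewrite eq_le fr_ge0 andbT leNgt; apply/negP => fr_gt0.
have : 0 < sin (pi * ratr (fracpart x)) :> R.
  apply: sin_gt0_pi; rewrite mulr_gt0 ?pi_gt0 ?ltr0q //=.
  by rewrite -[ltRHS]mulr1 ltr_pM2l ?pi_gt0 // -(rmorph1 (@ratr R)) ltr_rat.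
by move/(exprn_gt0 2); rewrite sin2cos2; lra.
Qed.

Lemma exp2pii_eq x y : (e x == e y) = (x - y \is a Num.int).
Proof.
rewrite -exp2pii_eq1 -(inj_eq (mulIf (exp2pii_neq0 (- y)))) -!exp2piiD.
by rewrite subrr exp2pii0.
Qed.

Lemma exp2pii_prim_root k : (0 < k)%N -> k.-primitive_root (e k%:R^-1).
Proof.
move=> k_gt0; have kN0 : k%:R != 0 :> rat by rewrite pnatr_eq0 -lt0n.
rewrite /primitive_root_of_unity k_gt0; apply/forallP => i.
rewrite unity_rootE -exp2piiMn exp2pii_eq1; apply/eqP.
apply/idP/eqP => [/intrP[c /eqP]|->]; last by rewrite mulfV ?rpred1.
rewrite -(inj_eq (mulIf kN0)) divfK // !pmulrn -intrM eqr_int => /eqP Ei.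
apply/eqP; rewrite eqn_leq ltn_ord.
by apply: dvdn_leq => //; have : (k %| Posz i.+1)%Z by rewrite Ei dvdz_mull.
Qed.

(** The k numbers e(x + l/k) are distinct roots of a monic polynomial of degree k. *)
Lemma XnsubC_factor k x : (0 < k)%N ->
  'X^k - (e (k%:R * x))%:P = \prod_(l < k) ('X - (e (x + l%:R / k%:R))%:P).
Proof.
move=> k_gt0; have kN0 : k%:R != 0 :> rat by rewrite pnatr_eq0 -lt0n.
pose rs := [seq e (x + l%:R / k%:R) | l <- iota 0 k].
have -> : \prod_(l < k) ('X - (e (x + l%:R / k%:R))%:P)
    = \prod_(z <- rs) ('X - z%:P).
  rewrite big_map -(big_mkord xpredT (fun l => 'X - (e (x + l%:R / k%:R))%:P)).
  by rewrite /index_iota subn0.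
rewrite [LHS](@all_roots_prod_XsubC _ _ rs).
- by rewrite (monicP (monicXnsubC _ k_gt0)) scale1r.
- by rewrite size_XnsubC // size_map size_iota.
- apply/allP => _ /mapP[l _ ->]; rewrite /root !hornerE subr_eq0 -exp2piiMn.
  rewrite mulrDr mulrCA mulfV // mulr1 exp2piiD.
  by rewrite (exp2pii_int (natr_int _ l)) mulr1.
rewrite uniq_rootsE map_inj_in_uniq ?iota_uniq // => i j.
rewrite !mem_iota !add0n /= => ik jk /eqP.
rewrite exp2pii_eq opprD addrACA subrr add0r -mulrBl => /intrP[c /eqP].
rewrite -(inj_eq (mulIf kN0)) divfK // !pmulrn -rmorphB -intrM eqr_int => /eqP.
have k0 : (0 < (k : int))%R by rewrite ltz_nat.
by case: (ltrgtP c 0) => c0; nia.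
Qed.

Lemma Xn_sub1_neq0 k : (0 < k)%N -> 'X^k - 1 != 0 :> {poly R[i]}.
Proof. by move=> k_gt0; rewrite -size_poly_eq0 size_XnsubC. Qed.

Lemma mup_Xn_sub1 k (y : R[i]) : (0 < k)%N -> mup y ('X^k - 1) = (y ^+ k == 1).
Proof.
move=> k_gt0; have prim := exp2pii_prim_root k_gt0.
rewrite -(factor_Xn_sub_1 prim) -(big_map _ xpredT (fun z => 'X - z%:P)).
rewrite mu_prod_XsubC count_uniq_mem.
  rewrite -root_prod_XsubC big_map (factor_Xn_sub_1 prim) /root !hornerE.
  by rewrite subr_eq0.
rewrite -separable_prod_XsubC big_map (factor_Xn_sub_1 prim).
by rewrite separable_Xn_sub_1 // pnatr_eq0 -lt0n.
Qed.

Section Exponents.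
Local Notation prodX P := (\prod_(k <- P) ('X^k - 1) : {poly R[i]}).

Lemma prodX_neq0 P : all (ltn 0) P -> prodX P != 0.
Proof.
move=> /allP P_gt0; rewrite prodf_seq_neq0; apply/allP => k kP.
exact/Xn_sub1_neq0/P_gt0.
Qed.

Lemma mup_prodX P (y : R[i]) : all (ltn 0) P ->
  mup y (prodX P) = (\sum_(k <- P) (y ^+ k == 1)%R)%N.
Proof.
elim: P => [_|k P IHP /= /andP[k_gt0 P_gt0]].
  by rewrite !big_nil mupNroot // /root hornerC oner_neq0.
by rewrite !big_cons mupM ?Xn_sub1_neq0 ?prodX_neq0 // mup_Xn_sub1 // IHP.
Qed.

(* At a primitive M-th root of unity, M the largest exponent in P, the
   product over P vanishes; so M divides an exponent in Q. *)
Lemma prodX_inj P Q : all (ltn 0) P -> all (ltn 0) Q ->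
  prodX P = prodX Q -> perm_eq P Q.
Proof.
have ub P1 Q1 k : all (ltn 0) P1 -> all (ltn 0) Q1 -> prodX P1 = prodX Q1 ->
    k \in P1 -> exists2 k', k' \in Q1 & (k <= k')%N.
  move=> P_gt0 Q_gt0 PQ kP; have k_gt0 := allP P_gt0 _ kP.
  have prim := exp2pii_prim_root k_gt0.
  have : (0 < mup (e k%:R^-1) (prodX P1))%N.
    rewrite mup_prodX // lt0n sum_nat_seq_neq0; apply/hasP; exists k => //=.
    by rewrite eqb0 negbK (prim_expr_order prim).
  rewrite PQ mup_prodX // lt0n sum_nat_seq_neq0 => /hasP[k' k'Q] /=.
  rewrite eqb0 negbK -(prim_order_dvd prim) => /dvdn_leq le_kk'.
  by exists k' => //; apply: le_kk'; apply: (allP Q_gt0).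
elim: {P}(size P) {-2}P (leqnn (size P)) Q => [|s IHs] P.
  rewrite leqn0 size_eq0 => /eqP-> Q P_gt0 Q_gt0 PQ.
  case: Q Q_gt0 PQ => // k Q Q_gt0 PQ.
  by have [] := ub _ _ k Q_gt0 P_gt0 (esym PQ) (mem_head _ _).
move=> sP Q P_gt0 Q_gt0 PQ.
have [P0|[k0 k0P]] : P = [::] \/ exists k, k \in P.
  by case: (P) => [|k ?]; [left | right; exists k; apply: mem_head].
  rewrite P0 in P_gt0 PQ *; case: Q Q_gt0 PQ => // k Q Q_gt0 PQ.
  by have [] := ub _ _ k Q_gt0 P_gt0 (esym PQ) (mem_head _ _).
have [M MP maxM] : exists2 M, M \in P & forall k, k \in P -> (k <= M)%N.
  have bP k : k \in P -> (k <= \max_(j <- P) j)%N.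
    by move=> kP; rewrite (big_rem _ kP) leq_maxl.
  have ex : exists k, k \in P by exists k0.
  by case: (ex_maxnP ex bP) => M; exists M.
have MQ : M \in Q.
  have [k kQ leMk] := ub _ _ M P_gt0 Q_gt0 PQ MP.
  have [k' k'P lekk'] := ub _ _ k Q_gt0 P_gt0 (esym PQ) kQ.
  suff -> : M = k by [].
  by apply/eqP; rewrite eqn_leq leMk (leq_trans lekk') // maxM.
have pP := perm_to_rem MP; have pQ := perm_to_rem MQ.
apply: (perm_trans pP); rewrite perm_sym; apply: (perm_trans pQ).
rewrite perm_cons perm_sym; apply: IHs.
- by rewrite size_rem //; case: (size P) sP.
- by move: P_gt0; rewrite (perm_all _ pP) => /andP[].
- by move: Q_gt0; rewrite (perm_all _ pQ) => /andP[].
move: PQ; rewrite (perm_big _ pP) (perm_big _ pQ) !big_cons.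
by apply/mulfI/Xn_sub1_neq0/(allP P_gt0).
Qed.

(** Without denominators the relation lives among polynomials, where root multiplicities and the
    substitution of X^n for X are available. *)
Lemma exponents_eqP (I : finType) (alpha beta : I -> rat) P Q :
  exponents_eq R alpha beta P Q <->
  [/\ all (ltn 0) P, all (ltn 0) Q &
    \prod_i ('X - (e (alpha i))%:P) * prodX Q
    = \prod_i ('X - (e (beta i))%:P) * prodX P].
Proof.
have nz (gamma : I -> rat) : \prod_i ('X - (e (gamma i))%:P) != 0.
  by apply/prodf_neq0 => i _; rewrite polyXsubC_eq0.
rewrite /exponents_eq; split=> -[P_gt0 Q_gt0 eqPQ]; split=> //.
all: move: eqPQ; rewrite big_split /= prodfV -!rmorph_prod /=.
all: have nzQ := prodX_neq0 Q_gt0.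
  move/eqP; rewrite eqr_div ?tofrac_eq0 // -!rmorphM /= tofrac_eq => /eqP->.
  by rewrite mulrC.
move=> eqPQ; apply/eqP; rewrite eqr_div ?tofrac_eq0 // -!rmorphM /= eqPQ.
by rewrite mulrC.
Qed.

(** Compares the multiplicities of e(x) as a root of both sides. The summation formula uses being
    defined over Q only through this count. *)
Lemma exponents_eq_count (I : finType) (alpha beta : I -> rat) P Q x :
  exponents_eq R alpha beta P Q ->
  (\sum_i (alpha i - x \is a Num.int)%R + \sum_(k <- Q) (k%:R * x \is a Num.int)%R
  = \sum_i (beta i - x \is a Num.int)%R
    + \sum_(k <- P) (k%:R * x \is a Num.int)%R)%N.
Proof.
case/exponents_eqP => P_gt0 Q_gt0 /(congr1 (mup (e x))).
have nz (gamma : I -> rat) : \prod_i ('X - (e (gamma i))%:P) != 0.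
  by apply/prodf_neq0 => i _; rewrite polyXsubC_eq0.
rewrite !mupM ?prodX_neq0 ?nz // !mup_prodX //.
have mu gamma : mup (e x) (\prod_i ('X - (e (gamma i))%:P))
    = (\sum_(i : I) (gamma i - x \is a Num.int)%R)%N.
  rewrite -(big_map (e \o gamma) xpredT (fun z => 'X - z%:P)) mu_prod_XsubC.
  rewrite count_map -sum1_count big_mkcond; apply: eq_bigr => i _ /=.
  by rewrite exp2pii_eq; case: ifP.
have cnt (S : seq nat) : (\sum_(k <- S) (e x ^+ k == 1)%R
    = \sum_(k <- S) (k%:R * x \is a Num.int)%R)%N.
  by apply: eq_bigr => k _; rewrite -exp2piiMn exp2pii_eq1.
by rewrite !mu !cnt.
Qed.

Section Multiplication.
Variables (n : nat) (n_gt0 : (0 < n)%N) (I : finType).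
Implicit Types alpha beta : I -> rat.

Let shift alpha (il : I * 'I_n) : rat := alpha il.1 + il.2%:R / n%:R.

Lemma prodX_comp_Xn P : prodX P \Po 'X^n = prodX (map (muln n) P).
Proof.
rewrite rmorph_prod big_map; apply: eq_bigr => k _ /=.
by rewrite rmorphB rmorph1 /= comp_Xn_poly exprM.
Qed.

Lemma prod_shift alpha : \prod_il ('X - (e (shift alpha il))%:P)
  = \prod_i ('X - (e (n%:R * alpha i))%:P) \Po 'X^n.
Proof.
rewrite rmorph_prod -(pair_bigA _ (fun i l => 'X - (e (shift alpha (i, l)))%:P)).
apply: eq_bigr => i _; rewrite /shift /= -(XnsubC_factor _ n_gt0).
by rewrite rmorphB /= comp_polyX comp_polyC.
Qed.

(** Substituting X^n for X turns X^k - 1 into X^(n k) - 1, and X - e(n y) into the product of the X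
    - e(y + l/n). *)
Lemma exponents_eq_shift alpha beta P Q :
  exponents_eq R (fun i => n%:R * alpha i) (fun i => n%:R * beta i) P Q ->
  exponents_eq R (shift alpha) (shift beta) (map (muln n) P) (map (muln n) Q).
Proof.
case/exponents_eqP => P_gt0 Q_gt0 eqPQ; apply/exponents_eqP.
have gt0 (S : seq nat) : all (ltn 0) S -> all (ltn 0) (map (muln n) S).
  rewrite all_map => /allP S_gt0; apply/allP => k kS /=.
  by rewrite muln_gt0 n_gt0; apply: S_gt0.
split; rewrite ?gt0 // !prod_shift -!prodX_comp_Xn -!rmorphM /=.
by rewrite eqPQ.
Qed.

(** A common exponent could be cancelled from both lists, against minimality. *)
Lemma defined_over_Q_disjoint alpha beta P Q :
  defined_over_Q_with R alpha beta P Q -> forall k, k \in P -> k \notin Q.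
Proof.
case=> /exponents_eqP[P_gt0 Q_gt0 eqPQ] minPQ k kP; apply/negP => kQ.
have pP := perm_to_rem kP; have pQ := perm_to_rem kQ.
have k_gt0 := allP P_gt0 _ kP.
have /minPQ[le_size _] : exponents_eq R alpha beta (rem k P) (rem k Q).
  apply/exponents_eqP; split.
  - by move: P_gt0; rewrite (perm_all _ pP) => /andP[].
  - by move: Q_gt0; rewrite (perm_all _ pQ) => /andP[].
  apply: (mulfI (Xn_sub1_neq0 k_gt0)); rewrite mulrCA [RHS]mulrCA.
  by move: eqPQ; rewrite (perm_big _ pP) (perm_big _ pQ) !big_cons.
by move: le_size; rewrite (perm_size pP) /= ltnn.
Qed.

(** For a competing pair P', Q', multiplicative independence gives P' + nQ = Q' + nP as multisets.
    Since nP and nQ are disjoint, nP is contained in P' and nQ in Q'. *)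
Lemma defined_over_Q_with_shift alpha beta P Q :
  defined_over_Q_with R (fun i => n%:R * alpha i) (fun i => n%:R * beta i) P Q ->
  defined_over_Q_with R (shift alpha) (shift beta)
    (map (muln n) P) (map (muln n) Q).
Proof.
move=> defPQ; have disj := defined_over_Q_disjoint defPQ.
case: defPQ => /exponents_eq_shift eqPQ _; split=> // P' Q' eqPQ'.
move/exponents_eqP: eqPQ => [nP_gt0 nQ_gt0 eqPQ].
move/exponents_eqP: eqPQ' => [P'_gt0 Q'_gt0 eqPQ'].
set nP := map (muln n) P in nP_gt0 eqPQ *.
set nQ := map (muln n) Q in nQ_gt0 eqPQ *.
have cntE k : (count_mem k P' + count_mem k nQ = count_mem k Q' + count_mem k nP)%N.
  rewrite -!count_cat; apply/seq.permP: (pred1 k); apply: prodX_inj.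
  - by rewrite all_cat P'_gt0.
  - by rewrite all_cat Q'_gt0.
  rewrite !big_cat /=.
  have nz (gamma : I * 'I_n -> rat) : \prod_i ('X - (e (gamma i))%:P) != 0.
    by apply/prodf_neq0 => i _; rewrite polyXsubC_eq0.
  apply: (mulfI (mulf_neq0 (nz (shift alpha)) (nz (shift beta)))).
  set A := \prod_i _; set B := \prod_i _.
  transitivity ((B * prodX P') * (A * prodX nQ)); first by ring.
  by rewrite -eqPQ' eqPQ -/A -/B; ring.
have disjn k : k \in nP -> k \notin nQ.
  case/mapP=> k1 k1P ->; apply: contra (disj _ k1P) => /mapP[k2 k2Q /eqP].
  by rewrite eqn_pmul2l // => /eqP->.
have size_le (S T : seq nat) :
    (forall k, (count_mem k S <= count_mem k T)%N) -> (size S <= size T)%N.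
  by case/count_subseqP => s' /size_subseq le_s' /perm_size ->.
split; apply: size_le => k; have [kP|kNP] := boolP (k \in nP).
- by have := cntE k; rewrite (count_memPn (disjn k kP)); lia.
- by rewrite (count_memPn kNP).
- by rewrite (count_memPn (disjn k kP)).
by have := cntE k; rewrite (count_memPn kNP); lia.
Qed.

End Multiplication.
End Exponents.
End RootsOfUnity.

(** * Stability of the parameters modulo 1 under multiplication by units *)

Section GaloisInvariance.
Variables (R : realType) (W s s' : nat) (ss'W : (s * s' = 1 %[mod W])%N).
Implicit Types x y : rat.

Let int_div x : W%:R * x \is a Num.int -> (s * s')%:R * x - x \is a Num.int.
Proof.
move=> Wx; have [ss'_gt0|] := ltnP 0 (s * s'); last first.
  (* If s s' = 0, the congruence forces W = 1, and x itself is an integer. *)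
  move: ss'W; rewrite leqn0 => + /eqP ss'0; rewrite ss'0 mod0n.
  case: (W) Wx => [_|[|w] Wx]; first by [].
    by rewrite mul1r in Wx; rewrite mul0r sub0r rpredN.
  by rewrite modn_small.
have /dvdnP[c Ec] : (W %| s * s' - 1)%N by rewrite -eqn_mod_dvd //; apply/eqP.
have -> : (s * s')%:R * x - x = c%:R * (W%:R * x).
  have -> : (s * s')%N = (c * W + 1)%N by rewrite -Ec subnK.
  by rewrite natrD natrM; ring.
by rewrite rpredM ?natr_int.
Qed.

Let int_scale k x : W%:R * x \is a Num.int ->
  ((k%:R * (s'%:R * x) \is a Num.int) = (k%:R * x \is a Num.int)).
Proof.
move=> Wx; apply/idP/idP => kx; last by rewrite mulrCA rpredM ?natr_int.
have -> : k%:R * x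
    = s%:R * (k%:R * (s'%:R * x)) - k%:R * ((s * s')%:R * x - x).
  by rewrite natrM; ring.
by apply: rpredB; apply: rpredM; rewrite ?natr_int ?int_div.
Qed.

Let int_shift y x : W%:R * y \is a Num.int -> W%:R * x \is a Num.int ->
  (s%:R * y - x \is a Num.int) = (y - s'%:R * x \is a Num.int).
Proof.
move=> Wy Wx; apply/idP/idP => yx.
  have -> : y - s'%:R * x
      = s'%:R * (s%:R * y - x) - ((s * s')%:R * y - y) by rewrite natrM; ring.
  by apply: rpredB; [apply: rpredM|]; rewrite ?natr_int ?int_div.
have -> : s%:R * y - x
      = s%:R * (y - s'%:R * x) + ((s * s')%:R * x - x) by rewrite natrM; ring.
by apply: rpredD; [apply: rpredM|]; rewrite ?natr_int ?int_div.
Qed.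

(** At x, the count of the alpha minus that of the beta is the number of k in P minus the number of
    k in Q with k x integral, which is the same at s' x. So the formal difference of the alpha and
    beta modulo 1 is stable under multiplication by s; concatenation states this without signs. *)
Lemma exponents_eq_mulr (I : finType) (alpha beta : I -> rat) P Q :
  exponents_eq R alpha beta P Q ->
  (forall i, W%:R * alpha i \is a Num.int) ->
  (forall i, W%:R * beta i \is a Num.int) ->
  perm_eq ([seq fracpart (s%:R * alpha i) | i <- enum I]
             ++ [seq fracpart (beta i) | i <- enum I])
          ([seq fracpart (alpha i) | i <- enum I]
             ++ [seq fracpart (s%:R * beta i) | i <- enum I]).
Proof.
move=> eqPQ alphaW betaW; apply/allP => x _ /=; rewrite !count_cat.
have cntE (gamma : I -> rat) :
    count_mem x [seq fracpart (gamma i) | i <- enum I]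
    = (\sum_i (fracpart (gamma i) == x))%N.
  rewrite count_map -sum1_count big_mkcond big_enum.
  by apply: eq_bigr => i _ /=; case: (_ == _).
rewrite (cntE (fun i => s%:R * alpha i)) (cntE alpha).
rewrite (cntE (fun i => s%:R * beta i)) (cntE beta).
have [/andP[x01 Wx]|xN] := boolP ((0 <= x < 1) && (W%:R * x \is a Num.int)).
  have frE y : (fracpart y == x) = (y - x \is a Num.int).
    rewrite -{1}(fracpart_id x01); apply/eqP/idP => [/fracpart_inj//|].
    exact: fracpart_eq.
  have frS (gamma : I -> rat) : (\sum_i (fracpart (gamma i) == x)
      = \sum_i (gamma i - x \is a Num.int)%R)%N.
    by apply: eq_bigr => i _; rewrite frE.
  have shS (gamma : I -> rat) : (forall i, W%:R * gamma i \is a Num.int) ->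
      (\sum_i (s%:R * gamma i - x \is a Num.int)%R
      = \sum_i (gamma i - s'%:R * x \is a Num.int)%R)%N.
    by move=> gammaW; apply: eq_bigr => i _; rewrite int_shift.
  have scS (S : seq nat) :
      (\sum_(k <- S) (k%:R * (s'%:R * x) \is a Num.int)%R
      = \sum_(k <- S) (k%:R * x \is a Num.int)%R)%N.
    by apply: eq_bigr => k _; rewrite int_scale.
  rewrite (frS (fun i => s%:R * alpha i)) (frS alpha).
  rewrite (frS (fun i => s%:R * beta i)) (frS beta) !shS //.
  have := exponents_eq_count (s'%:R * x) eqPQ; rewrite !scS.
  have := exponents_eq_count x eqPQ; move=> E1 E2; apply/eqP.
  have cross (a b c d u v : nat) : (a + u = b + v -> c + u = d + v ->
      c + b = a + d)%N by lia.
  exact: cross E1 E2.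
(* Any other x is no fractional part of a number with denominator dividing W, so all four counts are
   0. *)
have noteq (gamma : I -> rat) : (forall i, W%:R * gamma i \is a Num.int) ->
    (\sum_i (fracpart (gamma i) == x) = 0)%N.
  move=> gammaW; apply: big1 => i _; apply/eqP; rewrite eqb0.
  apply: contra xN => /eqP <-; rewrite fracpart_itv.
  have -> : W%:R * fracpart (gamma i)
     = W%:R * (fracpart (gamma i) - gamma i) + W%:R * gamma i by ring.
  by apply: rpredD => //; apply: rpredM; rewrite ?natr_int ?fracpart_subr_int.
by rewrite !noteq // => i; rewrite mulrCA rpredM ?natr_int.
Qed.

End GaloisInvariance.

(** * Arithmetic of p-adic integers *)

Section PadicIntegerArithmetic.
Variables (p : nat) (p_pr : prime p).
Local Notation Zp := (padic_int p_pr).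
Implicit Types (x y : Zp) (a b : rat).

Lemma residue_nat k n : (k%:R : Zp) n = (k %% p ^ n)%N.
Proof.
elim: k => [|k IHk]; first by [].
by rewrite -[k.+1]addn1 natrD /= -/(k%:R : Zp) IHk modnDm.
Qed.

Lemma residueD x y n : (x + y) n = ((x n + y n) %% p ^ n)%N. Proof. by []. Qed.

Lemma residueM x y n : (x * y) n = ((x n * y n) %% p ^ n)%N. Proof. by []. Qed.

Lemma residue_eqD x x' y y' n : x n = x' n -> y n = y' n -> (x + y) n = (x' + y') n.
Proof. by rewrite !residueD => -> ->. Qed.

Lemma residue_eqM x x' y y' n : x n = x' n -> y n = y' n -> (x * y) n = (x' * y') n.
Proof. by rewrite !residueM => -> ->. Qed.

Lemma residue_eq_prod (I : finType) (f g : I -> Zp) n :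
  (forall i, f i n = g i n) -> (\prod_i f i) n = (\prod_i g i) n.
Proof.
by move=> fg; elim/big_ind2: _ => // x x' y y'; apply: residue_eqM.
Qed.

Lemma residue_eq_le x y m n : (m <= n)%N -> x n = y n -> x m = y m.
Proof. by move=> le_mn xy; rewrite (residue_le x le_mn) (residue_le y le_mn) xy. Qed.

Lemma padic_natr_eq0 k : (k%:R == 0 :> Zp) = (k == 0%N).
Proof.
apply/eqP/eqP => [k0|->//]; have := congr1 (fun z : Zp => z k) k0.
by rewrite -[0]/(0%:R) !residue_nat mod0n modn_small // ltn_expl ?prime_gt1.
Qed.

Lemma padic_intr_eq0 (k : int) : (k%:~R == 0 :> Zp) = (k == 0).
Proof.
case: k => k; first by rewrite -pmulrn padic_natr_eq0.
by rewrite NegzE mulrNz !oppr_eq0 -pmulrn padic_natr_eq0.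
Qed.

Lemma padic_dvd_expn x n : x n = 0%N -> exists y, x = p%:R ^+ n * y.
Proof.
move=> xn0; have dvdx k : (p ^ n %| x (n + k))%N.
  by rewrite /dvdn -residue_le ?leq_addr // xn0.
(* Division by p^n costs n digits of precision, whence the index n + k. *)
pose f k := (x (n + k) %/ p ^ n)%N.
have fP k : (f k.+1 = f k %[mod p ^ k])%N.
  apply/eqP; rewrite -(eqn_pmul2l (padic_expn_gt0 p_pr n)) !muln_modr -expnD.
  rewrite ![(p ^ n * f _)%N]mulnC !divnK // addnS.
  by rewrite -(residueP x (n + k)) residue_mod.
exists (mkpadic p_pr fP); apply: padic_intP => k.
rewrite -natrX residueM residue_nat /= modnMmr modnMml /f mulnC divnK //.
exact: residue_le (leq_addl n k).
Qed.

Lemma padic_unitE x : (x \is a GRing.unit) = ~~ (p %| x 1%N)%N.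
Proof.
apply/idP/idP => [/unitrP[y [yx1 _]]|px].
  have : (y * x) 1%N = 1%N by rewrite yx1 /= modn_small // expn1 prime_gt1.
  rewrite residueM expn1 => yx; apply: contra_eqN yx => /dvdnP[c ->].
  by rewrite mulnA modnMl.
have cop k : coprime (x k) (p ^ k).
  case: k => [|k]; first by rewrite expn0 coprimen1.
  rewrite coprimeXr // coprime_sym prime_coprime //; apply: contra px => px.
  by rewrite (residue_le x (ltn0Sn k)) expn1 /dvdn modn_mod.
(* The inverse modulo p^k given by Euler's theorem. *)
pose f k := (x k ^ (totient (p ^ k)).-1)%N.
have fx k : (f k * x k = 1 %[mod p ^ k])%N.
  rewrite /f -expnSr prednK ?totient_gt0 ?padic_expn_gt0 //.
  exact: Euler_exp_totient.
have fP k : (f k.+1 = f k %[mod p ^ k])%N.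
  have fx' : (f k.+1 * x k = 1 %[mod p ^ k])%N.
    rewrite (residueP x k) modnMmr -[LHS](@modn_dvdm (p ^ k.+1)).
      by rewrite fx modn_dvdm // dvdn_exp2l.
    by rewrite dvdn_exp2l.
  rewrite -[f k.+1]muln1 -modnMmr -(fx k) modnMmr mulnCA -modnMmr fx' modnMmr.
  by rewrite muln1.
apply/unitrPr; exists (mkpadic p_pr fP); apply: padic_intP => k.
by rewrite residueM /= modnMmr mulnC fx.
Qed.

Lemma padic_natr_unit k : ((k%:R : Zp) \is a GRing.unit) = coprime p k.
Proof. by rewrite padic_unitE residue_nat expn1 /dvdn modn_mod prime_coprime. Qed.

(** The denominator d need not be reduced, which makes closure under sums and products immediate. *)
Lemma padic_integralP a :
  reflect (exists2 d, coprime p d & d%:R * a \is a Num.int) (coprime p `|denq a|).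
Proof.
apply: (iffP idP) => [co|[d co_d /intrP[m Em]]].
  exists `|denq a|%N => //.
  rewrite pmulrn absz_denq mulrC -{1}[a]divq_num_den divfK ?intr_int //.
  by rewrite intr_eq0 denq_neq0.
apply: coprime_dvdr co_d.
have : (denq a %| (d : int))%Z.
  rewrite -(@Gauss_dvdzr _ (numq a)); last first.
    by rewrite coprimezE coprime_sym; apply: coprime_num_den.
  apply/dvdzP; exists m; apply/eqP; rewrite -(eqr_int rat) !intrM -Em.
  rewrite -{2}[a]divq_num_den -pmulrn; apply/eqP.
  by field; rewrite intr_eq0 denq_neq0.
by rewrite dvdzE.
Qed.

Lemma padic_integral_intr d a :
  coprime p d -> d%:R * a \is a Num.int -> padic_integral p a.
Proof. by move=> co_d da; apply/padic_integralP; exists d. Qed.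

Lemma padic_integralD a b :
  padic_integral p a -> padic_integral p b -> padic_integral p (a + b).
Proof.
move=> /padic_integralP[c co_c ca] /padic_integralP[d co_d db].
apply: (@padic_integral_intr (c * d)); first by rewrite coprimeMr co_c.
have -> : (c * d)%:R * (a + b) = d%:R * (c%:R * a) + c%:R * (d%:R * b).
  by rewrite natrM; ring.
by apply: rpredD; apply: rpredM; rewrite ?natr_int.
Qed.

Lemma padic_integralM a b :
  padic_integral p a -> padic_integral p b -> padic_integral p (a * b).
Proof.
move=> /padic_integralP[c co_c ca] /padic_integralP[d co_d db].
apply: (@padic_integral_intr (c * d)); first by rewrite coprimeMr co_c.
have -> : (c * d)%:R * (a * b) = (c%:R * a) * (d%:R * b).
  by rewrite natrM; ring.
by apply: rpredM.
Qed.

Lemma padic_integral_int a : a \is a Num.int -> padic_integral p a.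
Proof. by move=> aZ; apply: (@padic_integral_intr 1); rewrite ?coprimen1 ?mul1r. Qed.

Lemma ratr_denq a : padic_integral p a ->
  ratr a * (denq a)%:~R = (numq a)%:~R :> Zp.
Proof.
move=> co_a; rewrite /ratr mulrVK //.
by rewrite -absz_denq -pmulrn padic_natr_unit.
Qed.

(** As Z_p is a domain of characteristic 0, any relation d a = m with d nonzero determines the image
    of a. This yields the additivity and multiplicativity of [ratr] on p-integral rationals. *)
Lemma ratr_eq a x (d m : int) : padic_integral p a -> d != 0 ->
  d%:~R * a = m%:~R -> d%:~R * x = m%:~R -> x = ratr a.
Proof.
move=> a_int d0 da dx; have dq0 := denq_neq0 a.
have : d%:~R * (denq a)%:~R != 0 :> Zp.
  by rewrite -intrM padic_intr_eq0 mulf_neq0.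
move/mulfI; apply.
have E : d * numq a = m * denq a.
  apply/eqP; rewrite -(eqr_int rat) !intrM -da -{2}[a]divq_num_den.
  by rewrite -mulrA divfK // intr_eq0.
by rewrite mulrAC dx -mulrA [_ * ratr a]mulrC ratr_denq // -!intrM E.
Qed.

Lemma padic_ratrD a b : padic_integral p a -> padic_integral p b ->
  ratr (a + b) = ratr a + ratr b :> Zp.
Proof.
move=> a_int b_int; symmetry.
apply: (@ratr_eq _ _ (denq a * denq b) (numq a * denq b + numq b * denq a)).
- exact: padic_integralD.
- by rewrite mulf_neq0 ?denq_neq0.
- rewrite -{2}[a]divq_num_den -{2}[b]divq_num_den intrD !intrM; field.
  by rewrite !intr_eq0 !denq_neq0.
by rewrite intrD !intrM -!ratr_denq //; ring.
Qed.

Lemma padic_ratrM a b : padic_integral p a -> padic_integral p b ->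
  ratr (a * b) = ratr a * ratr b :> Zp.
Proof.
move=> a_int b_int; symmetry.
apply: (@ratr_eq _ _ (denq a * denq b) (numq a * numq b)).
- exact: padic_integralM.
- by rewrite mulf_neq0 ?denq_neq0.
- rewrite -{2}[a]divq_num_den -{2}[b]divq_num_den !intrM; field.
  by rewrite !intr_eq0 !denq_neq0.
by rewrite !intrM -!ratr_denq //; ring.
Qed.

End PadicIntegerArithmetic.

(** * The multiplication formula for the p-adic gamma function *)

Section MoritaGamma.
Variables (p : nat) (p_pr : prime p).
Local Notation Zp := (padic_int p_pr).
Variables (G : Zp -> Zp) (GP : morita_gamma_spec G).
Implicit Types x y : Zp.

(** The multiplier in the functional equation of Morita's function; [x 1] is x modulo p. *)
Definition gamma_factor x : Zp := if (p %| x 1)%N then -1 else - x.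
Local Notation factor := gamma_factor.

Lemma gamma_factor_residue x y n : (0 < n)%N -> x n = y n -> factor x n = factor y n.
Proof.
move=> n_gt0 xy; rewrite /gamma_factor (residue_eq_le n_gt0 xy).
by case: ifP => // _; rewrite -[- x]mulN1r -[- y]mulN1r; apply: residue_eqM.
Qed.

Lemma gamma_natS N : (0 < N)%N -> G N.+1%:R = factor N%:R * G N%:R.
Proof.
case: GP => _ _ GN N_gt0; rewrite !GN //.
rewrite big_mkcond big_nat_recr //= -big_mkcond /=.
rewrite /gamma_factor residue_nat expn1 /dvdn modn_mod exprS.
by case: eqP => _ /=; ring.
Qed.

(** Adding p^n makes the integer approximating x positive even when its residue is 0, so that the
    product formula for Gamma_p applies. *)
Lemma nat_residue x n m : (m <= n)%N ->
  ((x n + p ^ n)%:R : Zp) m = x m.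
Proof.
move=> le_mn; rewrite residue_nat (residue_le x le_mn) -modnDmr.
have /eqP-> : (p ^ m %| p ^ n)%N by rewrite dvdn_exp2l.
by rewrite addn0.
Qed.

(** The equation holds at the positive integers, which are dense, and both sides are continuous. *)
Lemma gammaS x : G (x + 1) = factor x * G x.
Proof.
have [G_cont _ _] := GP.
(* The precision is kept positive because the case distinction in [gamma_factor] depends on x modulo
   p. *)
suff E n : G (x + 1) n.+1 = (factor x * G x) n.+1.
  by apply: padic_intP => n; apply: (residue_eq_le (leqnSn n)).
have [m1 m1P] := G_cont (x + 1) n.+1; have [m2 m2P] := G_cont x n.+1.
pose k := maxn n.+1 (maxn m1 m2).
have [le1 le2] : (m1 <= k)%N /\ (m2 <= k)%N by rewrite /k; lia.
pose N := (x k + p ^ k)%N.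
have N_gt0 : (0 < N)%N by rewrite addn_gt0 padic_expn_gt0 ?orbT.
rewrite -(m1P N.+1%:R) => [|]; last first.
  by rewrite -addn1 natrD; apply: residue_eqD => //; apply: nat_residue.
rewrite gamma_natS //; apply: residue_eqM; last by rewrite m2P // nat_residue.
by apply: gamma_factor_residue => //; apply: nat_residue; rewrite leq_maxl.
Qed.

(** Modulo p the value is that at a positive integer, a product of units up to sign. *)
Lemma gamma_neq0 x : G x != 0.
Proof.
have [G_cont _ GN] := GP; have [m mP] := G_cont x 1%N.
suff : G x \is a GRing.unit by apply: contraTneq => ->; rewrite unitr0.
rewrite padic_unitE -(mP (x m + p ^ m)%:R) ?nat_residue // -padic_unitE.
rewrite GN ?addn_gt0 ?padic_expn_gt0 ?orbT // rpredM ?rpredX ?unitrN1 //.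
apply: rpred_prod => j pj.
by rewrite padic_natr_unit prime_coprime.
Qed.

Variables (n : nat) (co_pn : coprime p n) (n_gt0 : (0 < n)%N).

Let nU : (n%:R : Zp) \is a GRing.unit.
Proof. by rewrite padic_natr_unit. Qed.

Definition gamma_prod x : Zp := \prod_(h < n) G ((x + h%:R) / n%:R).
Local Notation H := gamma_prod.

(** Passing to x + 1 moves each h to h + 1: the product loses Gamma_p(x/n) and gains Gamma_p(x/n +
    1). *)
Lemma gamma_prodS x : H (x + 1) = factor (x / n%:R) * H x.
Proof.
have nzG : G (x / n%:R) != 0 by apply: gamma_neq0.
apply: (mulfI nzG).
pose f h := G ((x + h%:R) / n%:R).
have -> : H (x + 1) = \prod_(h < n) f h.+1.
  by apply: eq_bigr => h _; rewrite /f -[h.+1]add1n natrD addrA.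
have -> : H x = \prod_(h < n) f h by [].
have -> : G (x / n%:R) = f 0%N by rewrite /f addr0.
have -> : factor (x / n%:R) = factor ((x + 0%:R) / n%:R) by rewrite addr0.
rewrite -(big_ord_recl n (fun i => f (nat_of_ord i)) ) big_ord_recr /=.
have -> : f n = factor ((x + 0%:R) / n%:R) * f 0%N.
  by rewrite /f -gammaS addr0 mulrDl mulrV.
by rewrite mulrCA mulrA mulrC mulrA.
Qed.

(* The number of integers in [1, K] prime to p is K - K %/ p. *)
Lemma gamma_prod_opp_nat K :
  H (- K%:R) = H 0 * n%:R ^+ (K - K %/ p) * G (- K%:R).
Proof.
elim: K => [|K IHK].
  by case: GP => _ G0 _; rewrite oppr0 div0n subn0 expr0 G0 !mulr1.
set x : Zp := - K.+1%:R.
have xS : x + 1 = - K%:R by rewrite /x -addn1 natrD opprD addrNK.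
have cnt : (K.+1 - K.+1 %/ p = K - K %/ p + ~~ (p %| K.+1))%N.
  rewrite divnS ?prime_gt0 //; have := leq_div K p.
  by case: (p %| K.+1)%N; lia.
have pxE : (p %| x 1)%N = (p %| K.+1)%N.
  apply: negb_inj.
  by rewrite -padic_unitE unitrN padic_natr_unit prime_coprime.
(* A multiple of p contributes -1 on both sides; otherwise -x/n lacks a factor n, which accounts for
   the power of n. *)
have fE : (n%:R : Zp) ^+ (~~ (p %| K.+1)%N) * factor (x / n%:R) = factor x.
  have dvd_div : (p %| (x / n%:R)%R 1)%N = (p %| x 1)%N.
    by apply: negb_inj; rewrite -!padic_unitE unitrMl ?unitrV.
  rewrite /gamma_factor dvd_div pxE; case: (p %| K.+1)%N; rewrite ?mul1r //.
  by rewrite expr1 mulrN mulrC mulrVK.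
have f_neq0 : factor (x / n%:R) != 0.
  rewrite /gamma_factor; case: ifP => _; rewrite oppr_eq0 ?oner_neq0 //.
  have nV0 : n%:R^-1 != 0 :> Zp.
    by apply: contraTneq nU => nV0; rewrite -unitrV nV0 unitr0.
  by rewrite mulf_neq0 // oppr_eq0 padic_natr_eq0.
apply: (mulfI f_neq0); rewrite -gamma_prodS xS IHK cnt exprD.
have -> : G (- K%:R) = factor x * G x by rewrite -gammaS xS.
by rewrite -fE; ring.
Qed.

Lemma padic_bound (J : finType) (P : J -> nat -> Prop) :
  (forall j, exists m, forall k, (m <= k)%N -> P j k) ->
  exists m, forall j k, (m <= k)%N -> P j k.
Proof.
move=> /choice[f fP]; exists (\max_j f j) => j k le_k; apply: fP.
by apply: leq_trans le_k; apply: leq_bigmax.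
Qed.

(** Stated for all k from m on, so that the thresholds of finitely many points can be replaced by
    their maximum. *)
Lemma gamma_continuous x M :
  exists m, forall k, (m <= k)%N -> forall y, y k = x k -> G y M = G x M.
Proof.
have [G_cont _ _] := GP; have [m mP] := G_cont x M; exists m => k le_mk y yx.
by apply/mP/(residue_eq_le le_mk).
Qed.

Lemma gamma_prod_continuous x M :
  exists m, forall k, (m <= k)%N -> forall y, y k = x k -> H y M = H x M.
Proof.
have [|m mP] := @padic_bound _ (fun (h : 'I_n) k => forall y,
   y k = ((x + h%:R) / n%:R) k -> G y M = G ((x + h%:R) / n%:R) M).
  by move=> h; apply: gamma_continuous.
exists m => k le_mk y yx; apply: residue_eq_prod => h; apply: (mP h k le_mk).
by apply: residue_eqM => //; apply: residue_eqD.
Qed.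

Section Periodic.
Variables (N : nat) (N_gt0 : (0 < N)%N).
Local Notation W := (p ^ N - 1)%N.
(** Modulo 1, on the z with W z integral, multiplication by p^(N-1) is inverse to multiplication by
    p, because p^N = 1 modulo W. *)
Local Notation pred_p z := (fracpart ((p ^ N.-1)%:R * z)).

Let expN : (p ^ N = p * p ^ N.-1)%N.
Proof. by rewrite -expnS prednK. Qed.

(* For Q = p^(N M), -z (Q - 1) is a negative integer congruent to z modulo Q. *)
Section Approximation.
Variables (M : nat) (M_gt0 : (0 < M)%N).
Local Notation Q := (p ^ (N * M))%N.

Let dvdWQ : (W %| Q - 1)%N.
Proof. by rewrite expnM; apply/dvdnP; exists (\sum_(i < M) (p ^ N) ^ i)%N;
  rewrite mulnC !subn1 predn_exp. Qed.

Let approx (z : rat) := `|Num.floor (z * (Q - 1)%:R)|%N.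

Lemma approxE z : 0 <= z -> W%:R * z \is a Num.int ->
  (approx z)%:R = z * (Q - 1)%:R :> rat.
Proof.
move=> z_ge0 Wz; rewrite pmulrn /approx gez0_abs; last first.
  by rewrite floor_ge0 mulr_ge0.
apply/eqP; rewrite -intrEfloor; case/dvdnP: dvdWQ => c ->.
by rewrite natrM mulrCA (mulrC z) rpredM ?natr_int.
Qed.

Lemma ratr_approx z : 0 <= z -> W%:R * z \is a Num.int ->
  (ratr z : Zp) (N * M)%N = (- (approx z)%:R : Zp) (N * M)%N.
Proof.
move=> z_ge0 Wz.
have Q_gt0 : (0 < Q)%N by apply: padic_expn_gt0.
have z_int : padic_integral p z.
  apply: padic_integral_intr Wz; rewrite -(coprime_pexpl _ _ N_gt0) subn1.
  by rewrite coprimenP ?padic_expn_gt0.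
have zQ : ratr z * (Q - 1)%:R = (approx z)%:R :> Zp.
  rewrite -!(ratr_nat Zp) approxE // padic_ratrM //.
  by apply/padic_integral_int/natr_int.
have -> : ratr z = - (approx z)%:R + Q%:R * ratr z :> Zp.
  by rewrite -zQ natrB //; ring.
rewrite residueD residueM residue_nat modnn mul0n mod0n addn0 residue_mod //.
Qed.

(* With z' the fractional part of p^(N-1) z, the integer m = p z' - z lies in
   [0, p) and is congruent to z (Q - 1) modulo p. *)
Lemma approx_count z : 0 <= z < 1 -> W%:R * z \is a Num.int ->
  (approx z - approx z %/ p)%:R = (z - pred_p z) * (Q - 1)%:R
    + (p%:R * pred_p z - z) * (Q %/ p)%:R :> rat.
Proof.
move=> z01 Wz; have [z_ge0 z_lt1] := andP z01.
have Q_gt0 : (0 < Q)%N by apply: padic_expn_gt0.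
have p_gt0 := prime_gt0 p_pr.
have pR_gt0 : 0 < p%:R :> rat by rewrite ltr0n.
have := fracpart_itv ((p ^ N.-1)%:R * z); rewrite -/(pred_p z) => z'01.
have [z'_ge0 z'_lt1] := andP z'01.
have Wz' : W%:R * pred_p z \is a Num.int.
  have -> : W%:R * pred_p z = W%:R * (pred_p z - (p ^ N.-1)%:R * z)
     + (p ^ N.-1)%:R * (W%:R * z) by ring.
  by apply: rpredD; apply: rpredM; rewrite ?natr_int ?fracpart_subr_int.
have QE : Q = (p * (Q %/ p))%N.
  by rewrite [(p * _)%N]mulnC divnK // dvdn_exp // muln_gt0 N_gt0.
have /intrP[c Ec] : p%:R * pred_p z - z \is a Num.int.
  have -> : p%:R * pred_p z - z
      = p%:R * (pred_p z - (p ^ N.-1)%:R * z) + W%:R * z.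
    by rewrite natrB ?padic_expn_gt0 // expN natrM; ring.
  by apply: rpredD => //; apply: rpredM; rewrite ?natr_int ?fracpart_subr_int.
have c_ge0 : 0 <= c.
  have : ((-1)%:~R : rat) < c%:~R.
    rewrite -Ec; have : 0 <= p%:R * pred_p z by rewrite mulr_ge0.
    by lra.
  by rewrite ltr_int; clear; lia.
have c_ltp : c < p.
  rewrite -(ltr_int rat) -Ec -pmulrn.
  have : p%:R * pred_p z < p%:R * 1 by rewrite ltr_pM2l.
  by lra.
have aE := approxE z_ge0 Wz; have a'E := approxE z'_ge0 Wz'.
have absE : `|c|%:R = p%:R * pred_p z - z :> rat.
  by rewrite Ec pmulrn gez0_abs.
have mul_div : (approx z + `|c| * (Q %/ p) * p
   = approx (pred_p z) * p + `|c|)%N.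
  apply/eqP; rewrite -(eqr_nat rat) !natrD !natrM aE a'E -mulrA.
  rewrite -[(Q %/ p)%:R * _]natrM [(_ * p)%N]mulnC -QE.
  by rewrite absE natrB //; apply/eqP; ring.
(* Divide the previous identity by p: the remainder |c| is less than p. *)
have div_eq : (approx z %/ p + `|c| * (Q %/ p) = approx (pred_p z))%N.
  rewrite addnC -divnMDl // [LHS in (LHS %/ _)%N]addnC mul_div.
  by rewrite divnMDl // divn_small ?addn0 // -ltz_nat gez0_abs.
rewrite natrB ?leq_div // aE.
have -> : (approx z %/ p)%:R = (approx (pred_p z))%:R - `|c|%:R * (Q %/ p)%:R :> rat.
  by rewrite -div_eq natrD natrM; ring.
by rewrite a'E absE; ring.
Qed.

End Approximation.

Section ProductRatio.
Variables (J : finType) (zn zd : J -> rat).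
Hypothesis zn01 : forall j, 0 <= zn j < 1.
Hypothesis zd01 : forall j, 0 <= zd j < 1.
Hypothesis Wzn : forall j, W%:R * zn j \is a Num.int.
Hypothesis Wzd : forall j, W%:R * zd j \is a Num.int.
Hypothesis sum_int : \sum_j (zn j - zd j) \is a Num.int.
Hypothesis sum_pred :
  \sum_j (zn j - zd j) = \sum_j (pred_p (zn j) - pred_p (zd j)).

(** The multiplication formula for balanced families, cross-multiplied to stay in Z_p. At the
    integer approximations both sides have the same factors [H 0] and values of [G], and the
    exponents of n differ by a multiple of phi(Q). *)
Lemma gamma_prod_ratio :
  \prod_j (H (ratr (zn j)) * G (ratr (zd j)))
  = \prod_j (H (ratr (zd j)) * G (ratr (zn j))).
Proof.
apply: padic_intP => M0.
have cont (z : J -> rat) : exists m, forall j k, (m <= k)%N -> forall y,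
    y k = (ratr (z j) : Zp) k ->
    H y M0 = H (ratr (z j)) M0 /\ G y M0 = G (ratr (z j)) M0.
  apply: padic_bound => j.
  have [m1 m1P] := gamma_prod_continuous (ratr (z j)) M0.
  have [m2 m2P] := gamma_continuous (ratr (z j)) M0.
  exists (maxn m1 m2) => k; rewrite geq_max => /andP[le1 le2] y yz.
  by split; [apply: m1P yz | apply: m2P yz].
have [m1 m1P] := cont zn; have [m2 m2P] := cont zd.
(* As N is positive, N M exceeds the target precision M0 and both continuity thresholds. *)
pose M := (maxn M0 (maxn m1 m2)).+1; pose Q := (p ^ (N * M))%N.
have le_NM k : (k < M)%N -> (k <= N * M)%N.
  by move=> /ltnW le_kM; apply: leq_trans le_kM _; rewrite leq_pmull.
have [le0 le1 le2] : [/\ (M0 <= N * M)%N, (m1 <= N * M)%N & (m2 <= N * M)%N].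
  by split; apply: le_NM; rewrite /M ltnS; clear; lia.
have M_gt0 : (0 < M)%N by [].
clearbody M.
pose a (z : rat) := `|Num.floor (z * (Q - 1)%:R)|%N.
pose e (z : J -> rat) := (\sum_j (a (z j) - a (z j) %/ p))%N.
have apprP (z : J -> rat) m :
  (forall j, 0 <= z j < 1) -> (forall j, W%:R * z j \is a Num.int) ->
  (forall j k, (m <= k)%N -> forall y, y k = (ratr (z j) : Zp) k ->
    H y M0 = H (ratr (z j)) M0 /\ G y M0 = G (ratr (z j)) M0) ->
  (m <= N * M)%N -> forall j,
  G (- (a (z j))%:R) M0 = G (ratr (z j)) M0 /\
  (H 0 * n%:R ^+ (a (z j) - a (z j) %/ p) * G (- (a (z j))%:R)) M0
    = H (ratr (z j)) M0.
  move=> z01 Wz mP le_m j; have [z_ge0 _] := andP (z01 j).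
  have [] := mP j _ le_m (- (a (z j))%:R); first by rewrite ratr_approx.
  by rewrite -gamma_prod_opp_nat => -> ->.
have znP := apprP _ _ zn01 Wzn m1P le1; have zdP := apprP _ _ zd01 Wzd m2P le2.
(* Each argument is replaced by its negative integer approximation, first on the left, then on the
   right. *)
transitivity ((\prod_j (H 0 * n%:R ^+ (a (zn j) - a (zn j) %/ p) * G (- (a (zn j))%:R)
    * G (- (a (zd j))%:R))) M0).
  apply: residue_eq_prod => j; apply/esym/residue_eqM.
    by case: (znP j).
  by case: (zdP j).
transitivity ((\prod_j (H 0 * n%:R ^+ (a (zd j) - a (zd j) %/ p) * G (- (a (zd j))%:R)
    * G (- (a (zn j))%:R))) M0); last first.
  apply: residue_eq_prod => j; apply: residue_eqM.
    by case: (zdP j).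
  by case: (znP j).
have split_prod (z z' : J -> rat) :
    \prod_j (H 0 * n%:R ^+ (a (z j) - a (z j) %/ p) * G (- (a (z j))%:R)
    * G (- (a (z' j))%:R))
    = n%:R ^+ e z * (\prod_(j : J) H 0 * ((\prod_j G (- (a (z j))%:R))
       * (\prod_j G (- (a (z' j))%:R)))).
  by rewrite !big_split /= prodrXr -!mulrA mulrCA.
rewrite !split_prod (mulrC (\prod_j G (- (a (zd j))%:R))).
(* Only the powers of n are left to compare, and modulo Q is precise enough. *)
apply: residue_eqM => //.
apply: (residue_eq_le le0).
have pow_phi u k : ((n%:R : Zp) ^+ (k + u * totient Q)) (N * M)%N
    = ((n%:R : Zp) ^+ k) (N * M)%N.
  rewrite -!natrX !residue_nat expnD -modnMmr [(u * _)%N]mulnC expnM -modnXm.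
  rewrite Euler_exp_totient; last first.
    by rewrite coprimeXr // coprime_sym.
  by rewrite modnXm exp1n modnMmr muln1.
have {}eE (z : J -> rat) :
    (forall j, 0 <= z j < 1) -> (forall j, W%:R * z j \is a Num.int) ->
    (e z)%:R = \sum_j ((z j - pred_p (z j)) * (Q - 1)%:R
      + (p%:R * pred_p (z j) - z j) * (Q %/ p)%:R) :> rat.
  move=> z01 Wz; rewrite natr_sum; apply: eq_bigr => j _.
  exact: approx_count.
have phiE : totient Q = (p.-1 * (Q %/ p))%N.
  have NM_gt0 : (0 < N * M)%N by rewrite muln_gt0 N_gt0.
  rewrite /Q; case: (N * M)%N NM_gt0 => // k _.
  by rewrite totient_pfactor //= expnS mulKn ?prime_gt0.
have /intrP[t Et] := sum_int.
have eqe : (e zn)%:R - (e zd)%:R = t%:~R * (totient Q)%:R :> rat.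
  rewrite !eE // -sumrB.
  (* In the form (T - T') (Q - 1) + (p T' - T) Q/p; with T = T' = t this is t (p - 1) Q/p = t
     phi(Q). *)
  transitivity ((\sum_j (zn j - zd j) - \sum_j (pred_p (zn j) - pred_p (zd j)))
        * (Q - 1)%:R
      + (p%:R * \sum_j (pred_p (zn j) - pred_p (zd j)) - \sum_j (zn j - zd j))
        * (Q %/ p)%:R).
    rewrite mulr_sumr -!sumrB !mulr_suml -big_split /=.
    by apply: eq_bigr => j _; ring.
  rewrite -sum_pred subrr mul0r add0r Et phiE natrM -subn1.
  by rewrite natrB ?prime_gt0 //; ring.
have {}eqe : (e zn : int) - (e zd : int) = t * totient Q.
  by apply/eqP; rewrite -(eqr_int rat) rmorphB rmorphM /= -!pmulrn eqe.
(* The exponents are natural numbers, so the sign of t decides which one is written as the other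
   plus a multiple of phi(Q). *)
case: t {Et} eqe => t eqe.
  have -> : e zn = (e zd + t * totient Q)%N by lia.
  by rewrite pow_phi.
have -> : e zd = (e zn + t.+1 * totient Q)%N by move: eqe; rewrite NegzE; lia.
by rewrite pow_phi.
Qed.

End ProductRatio.
End Periodic.
End MoritaGamma.

(** * Teichmuller lifts *)

Section Teichmuller.
Variables (p : nat) (p_pr : prime p) (r : nat) (F : finFieldType).
Local Notation Zp := (padic_int p_pr).
Hypothesis cardF : #|F| = (p ^ r)%N.
Variables (L : fieldExtType ('Qp p_pr)) (res : L -> F).
Hypothesis resP : unramified_residue res.
Implicit Types (x y z w : L).

Local Notation iota := (in_alg L \o @tofrac Zp).
Local Notation O := (@integer_of_ext p p_pr L).
Local Notation q := (#|F|).

Let iota_inj : injective iota.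
Proof.
move=> a b /= /(fmorph_inj (in_alg L)) /eqP.
by rewrite tofrac_eq => /eqP.
Qed.

Lemma integer_of_padic (a : Zp) : O (iota a). Proof. exact: integral_id. Qed.
Lemma integer_of_ext0 : O 0. Proof. exact: integral0. Qed.
Lemma integer_of_ext1 : O 1. Proof. exact: integral1. Qed.
Lemma integer_of_ext_nat k : O k%:R. Proof. exact: integral_nat. Qed.
Lemma integer_of_extD x y : O x -> O y -> O (x + y).
Proof. exact: integral_add. Qed.
Lemma integer_of_extB x y : O x -> O y -> O (x - y).
Proof. exact: integral_sub. Qed.
Lemma integer_of_extM x y : O x -> O y -> O (x * y).
Proof. exact: integral_mul. Qed.
Lemma integer_of_extX x k : O x -> O (x ^+ k).
Proof.
move=> Ox; elim: k => [|k IHk]; first exact: integer_of_ext1.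
by rewrite exprS; apply: integer_of_extM.
Qed.
Lemma integer_of_ext_sum (I : Type) (s : seq I) (P : pred I) (f : I -> L) :
  (forall i, P i -> O (f i)) -> O (\sum_(i <- s | P i) f i).
Proof.
by move=> Of; elim/big_ind: _ => //; [exact: integer_of_ext0 | exact: integer_of_extD].
Qed.

Lemma residue1 : res 1 = 1. Proof. by case: resP. Qed.
Lemma residueD_ext x y : O x -> O y -> res (x + y) = res x + res y.
Proof. by case: resP => _ morph _ _ Ox Oy; case: (morph x y). Qed.
Lemma residueM_ext x y : O x -> O y -> res (x * y) = res x * res y.
Proof. by case: resP => _ morph _ _ Ox Oy; case: (morph x y). Qed.
Lemma residue0 : res 0 = 0.
Proof.
have O0 := integer_of_ext0; apply: (addrI (res 0)).
by rewrite -residueD_ext // !addr0.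
Qed.
Lemma residueB_ext x y : O x -> O y -> res (x - y) = res x - res y.
Proof.
move=> Ox Oy; apply: (addIr (res y)).
by rewrite -residueD_ext ?subrK //; apply: integer_of_extB.
Qed.
Lemma residueX_ext x k : O x -> res (x ^+ k) = res x ^+ k.
Proof.
move=> Ox; elim: k => [|k IHk]; first exact: residue1.
by rewrite !exprS residueM_ext ?IHk //; apply: integer_of_extX.
Qed.
Lemma residue_sum_ext (I : Type) (s : seq I) (P : pred I) (f : I -> L) :
  (forall i, P i -> O (f i)) ->
  res (\sum_(i <- s | P i) f i) = \sum_(i <- s | P i) res (f i).
Proof.
move=> Of; elim: s => [|i s IHs]; first by rewrite !big_nil residue0.
rewrite !big_cons; case: ifP => // Pi.
by rewrite residueD_ext ?IHs //; [exact: Of | exact: integer_of_ext_sum].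
Qed.

Lemma residue_eq0P x : O x -> (res x = 0 <-> exists2 y, O y & x = p%:R * y).
Proof. by case: resP => _ _ _; apply. Qed.

Lemma residue_p y : O y -> res (p%:R * y) = 0.
Proof.
move=> Oy; apply/residue_eq0P; last by exists y.
by apply: integer_of_extM => //; apply: integer_of_ext_nat.
Qed.

Let pX_neq0 k : p%:R ^+ k != 0 :> L.
Proof.
apply: expf_neq0; rewrite -(rmorph_nat iota) -(rmorph0 iota).
by rewrite (inj_eq iota_inj) padic_natr_eq0 -lt0n prime_gt0.
Qed.

Definition congruent_mod_p k x y := exists2 w, O w & x - y = p%:R ^+ k * w.

(** The ideal p^k O meets Z_p inside p^k Z_p. Inductively c = p^k b with b in p O; then b has
    residue 0 in F, so it is not a unit of Z_p and p divides it there. *)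
Lemma residue_padic_eq0 k (c : Zp) :
  (exists2 w, O w & iota c = p%:R ^+ k * w) -> c k = 0%N.
Proof.
elim: k => [|k IHk] [w Ow Ec]; first by have := residue_lt c 0; case: (c 0%N).
have /padic_dvd_expn[b Eb] : c k = 0%N.
  apply: IHk; exists (p%:R * w); last by rewrite mulrA -exprSr.
  by apply: integer_of_extM => //; apply: integer_of_ext_nat.
have Eb' : iota b = p%:R * w.
  apply: (mulfI (pX_neq0 k)); rewrite mulrA -exprSr -Ec Eb.
  by rewrite [RHS]rmorphM rmorphXn rmorph_nat.
have bNU : b \isn't a GRing.unit.
  apply/negP => bU; have : res (iota (b * b^-1)) = 0.
    have -> : res (iota (b * b^-1)) = res (iota b) * res (iota b^-1).
      by rewrite rmorphM residueM_ext //; apply: integer_of_padic.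
    by rewrite Eb' residue_p // mul0r.
  by rewrite mulrV // rmorph1 residue1 => /eqP; apply/negP/oner_neq0.
have {bNU} b1 : b 1%N = 0%N.
  move: bNU; rewrite padic_unitE negbK => /eqP b1.
  by rewrite -(residue_mod b 1) expn1.
have [d Ed] := padic_dvd_expn b1.
by rewrite Eb Ed mulrA -exprSr -natrX residueM residue_nat modnn mul0n mod0n.
Qed.

(** A nonzero x satisfies a monic equation with nonzero constant term, powers of X being divided
    out. That constant is x times an integral element, so it lies in every p^k O, hence in every p^k
    Z_p, and is 0: a contradiction. *)
Lemma ideal_p_separated x :
  O x -> (forall k, exists2 w, O w & x = p%:R ^+ k * w) -> x = 0.
Proof.
move=> Ox px; apply/eqP; apply: contraT => x_neq0.
have [f [f_monic f_root f0]] : exists f : {poly Zp},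
    [/\ f \is monic, root (map_poly iota f) x & f.[0] != 0].
  have [f] := Ox; elim: {f}(size f) {-2}f (leqnn (size f)) => [|s IHs] f.
    by rewrite leqn0 size_poly_eq0 => /eqP-> /monic_neq0/eqP.
  move=> sf f_monic f_root; have [|f0] := boolP (root f 0); last by exists f.
  case/factor_theorem => g; rewrite subr0 => Ef.
  have g_monic : g \is monic by move: f_monic; rewrite Ef monicMr ?monicX.
  apply: (IHs g) => //.
    by move: sf; rewrite Ef size_mulX ?monic_neq0.
  move: f_root; rewrite Ef rmorphM /= map_polyX rootM => /orP[//|].
  by rewrite /root hornerX (negPf x_neq0).
have : root (f - f.[0]%:P) 0 by rewrite /root !hornerE subrr.
case/factor_theorem => g; rewrite subr0 => Eg.
have Ef : f = g * 'X + f.[0]%:P by rewrite -Eg subrK.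
pose w := (map_poly iota g).[x].
have Ow : O w.
  rewrite /w; apply: integral_horner => //; apply/integral_poly => i.
  by rewrite coef_map; apply: integer_of_padic.
have Ef0 : iota f.[0] = x * - w.
  move: f_root; rewrite {1}Ef rmorphD rmorphM /= map_polyX map_polyC /root.
  rewrite hornerD hornerMX hornerC -/w addrC addr_eq0 => /eqP Ef0.
  by rewrite mulrN mulrC; apply: Ef0.
suff : f.[0] = 0 by move/eqP; rewrite (negPf f0).
apply: padic_intP => k; rewrite [RHS]mod0n; apply: residue_padic_eq0.
have [y Oy Ey] := px k; exists (y * - w); last by rewrite Ef0 Ey mulrA.
by apply: integer_of_extM => //; rewrite -sub0r; apply: integer_of_extB;
  [exact: integer_of_ext0|].
Qed.

Local Notation congr_p := congruent_mod_p.

Lemma congruent_mod_pB k x x' y y' :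
  congr_p k x x' -> congr_p k y y' -> congr_p k (x - y) (x' - y').
Proof.
move=> [w Ow xx'] [w' Ow' yy']; exists (w - w'); first exact: integer_of_extB.
by rewrite mulrBr -xx' -yy'; ring.
Qed.

Lemma congruent_mod_p_le j k x y : (j <= k)%N -> congr_p k x y -> congr_p j x y.
Proof.
move=> le_jk [w Ow xy]; exists (p%:R ^+ (k - j) * w).
  by apply: integer_of_extM => //; apply/integer_of_extX/integer_of_ext_nat.
by rewrite mulrA -exprD subnKC.
Qed.

Lemma congruent_mod_pP x y : O x -> O y -> congr_p 1 x y <-> res x = res y.
Proof.
move=> Ox Oy; have Oxy := integer_of_extB Ox Oy.
split=> [[w Ow xy]|xy].
  by apply/eqP; rewrite -subr_eq0 -residueB_ext // xy expr1 residue_p.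
have /residue_eq0P[//|w Ow Ew] : res (x - y) = 0.
  by rewrite residueB_ext // xy subrr.
by exists w => //; rewrite expr1.
Qed.

Lemma card_expn_gt0 : (0 < r)%N.
Proof.
by case: (r) cardF => // F1; have := finRing_gt1 F; rewrite F1.
Qed.

Lemma card_residue_eq0 : (#|F|%:R : F) = 0.
Proof.
have := card_finPcharP cardF p_pr => /pcharf0 p0.
by rewrite cardF natrX p0 expr0n -leqn0 leqNgt card_expn_gt0.
Qed.

(* x - y divides x^q - y^q, with a quotient congruent to q x^(q-1), hence to 0,
   modulo p. *)
Lemma congruent_mod_pXq k x y : (0 < k)%N -> O x -> O y ->
  congr_p k x y -> congr_p k.+1 (x ^+ q) (y ^+ q).
Proof.
move=> k_gt0 Ox Oy xy.
have res_xy : res x = res y.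
  by apply/(congruent_mod_pP Ox Oy)/(congruent_mod_p_le k_gt0).
pose s := \sum_(i < q) x ^+ (q.-1 - i) * y ^+ i.
have Osi (i : 'I_q) : O (x ^+ (q.-1 - i) * y ^+ i).
  by apply: integer_of_extM; apply: integer_of_extX.
have /residue_eq0P[|w Ow Ew] : res s = 0.
- rewrite /s residue_sum_ext //.
  transitivity (\sum_(i < q) res y ^+ q.-1).
    apply: eq_bigr => i _; rewrite residueM_ext ?residueX_ext ?res_xy //.
    - by rewrite -exprD subnK // -ltnS (leq_trans (ltn_ord i)) ?leqSpred.
    - exact: integer_of_extX.
    - exact: integer_of_extX.
  by rewrite sumr_const card_ord -mulr_natr card_residue_eq0 mulr0.
- exact: integer_of_ext_sum.
case: xy => v Ov xy; exists (v * w); first exact: integer_of_extM.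
by rewrite subrXX xy -/s Ew exprSr; ring.
Qed.

Lemma residue_lift : exists t : F -> L, forall c, O (t c) /\ res (t c) = c.
Proof.
have [_ _ lift _] := resP.
have : forall c, exists x, O x /\ res x = c.
  by move=> c; have [x Ox resx] := lift c; exists x.
by case/choice => t; exists t.
Qed.

Section Digits.
Variables (t : F -> L) (tP : forall c, O (t c) /\ res (t c) = c).

(* Collecting the digits equal to c, the sum of the p^k t(d_k) is the
   combination of the t(c) with coefficients in Z_p. *)
Lemma digits_limit (d : nat -> F) :
  exists2 z, O z & forall M, congr_p M z (\sum_(k < M) p%:R ^+ k * t (d k)).
Proof.
pose f c M := (\sum_(k < M) p ^ k * (d k == c))%N.
have fP c M : (f c M.+1 = f c M %[mod p ^ M])%N.
  by rewrite /f big_ord_recr /= addnC [(p ^ M * _)%N]mulnC modnMDl.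
pose s c : Zp := mkpadic p_pr (fP c).
have /choice[s' s'P] : forall cM, exists b,
    s cM.1 - (f cM.1 cM.2)%:R = p%:R ^+ cM.2 * b.
  move=> [c M] /=; apply: padic_dvd_expn.
  transitivity (residue (s c - s c) M); last by rewrite subrr /= mod0n.
  apply: residue_eqD => //; rewrite -mulN1r -[- s c]mulN1r.
  by apply: residue_eqM => //; rewrite residue_nat.
exists (\sum_c iota (s c) * t c).
  apply: integer_of_ext_sum => c _; apply: integer_of_extM.
    exact: integer_of_padic.
  by case: (tP c).
move=> M; exists (\sum_c iota (s' (c, M)) * t c).
  apply: integer_of_ext_sum => c _; apply: integer_of_extM.
    exact: integer_of_padic.
  by case: (tP c).
have -> : \sum_(k < M) p%:R ^+ k * t (d k) = \sum_c iota (f c M)%:R * t c.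
  transitivity (\sum_c \sum_(k < M) (p ^ k * (d k == c))%:R * t c).
    rewrite exchange_big /=; apply: eq_bigr => k _.
    rewrite (bigD1 (d k)) //= eqxx muln1 natrX big1 ?addr0 // => c.
    by rewrite eq_sym => /negPf->; rewrite muln0 mul0r.
  by apply: eq_bigr => c _; rewrite rmorph_nat natr_sum mulr_suml.
rewrite -sumrB mulr_sumr; apply: eq_bigr => c _.
rewrite -mulrBl -rmorphB (s'P (c, M)) mulrA; congr (_ * _).
by rewrite rmorphM rmorphXn rmorph_nat.
Qed.

(** A fixed point of the q-th power map is built digit by digit. If S^q = S + p^(k+1) w, adding to S
    the product of p^(k+1) and a lift of the residue of w does not change S^q modulo p^(k+2), so the
    new sum is fixed to one more digit. *)
Lemma teichmuller_lift c : c != 0 ->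
  exists z, [/\ O z, z ^+ q.-1 = 1 & res z = c].
Proof.
move=> c_neq0; have q_gt0 : (0 < q)%N by apply: leq_trans (finRing_gt1 F).
pose D k S := res ((S ^+ q - S) / p%:R ^+ k).
pose S := fix S k := if k is k'.+1
  then S k' + p%:R ^+ k'.+1 * t (D k'.+1 (S k')) else t c.
pose d k := if k is k'.+1 then D k'.+1 (S k') else c.
have SE k : S k = \sum_(i < k.+1) p%:R ^+ i * t (d i).
  elim: k => [|k IHk]; first by rewrite big_ord1 expr0 mul1r.
  by rewrite big_ord_recr /= -IHk.
have SP k : O (S k) /\ congr_p k.+1 (S k ^+ q) (S k).
  elim: k => [|k [OS [w Ow Ew]]].
    have [Ot res_t] := tP c; split=> //.
    apply/congruent_mod_pP => //; first exact: integer_of_extX.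
    by rewrite residueX_ext // res_t expf_card.
  have DE : D k.+1 (S k) = res w by rewrite /D Ew mulrC mulKf.
  have [Ot res_t] := tP (res w).
  have OpX : O (p%:R ^+ k.+1) by apply/integer_of_extX/integer_of_ext_nat.
  have OS' : O (S k.+1).
    by rewrite /= DE; apply: integer_of_extD => //; apply: integer_of_extM.
  split=> //.
  have SS : congr_p k.+1 (S k.+1) (S k).
    by exists (t (res w)) => //; rewrite /= DE addrC addKr.
  have [v Ov Ev] := congruent_mod_pXq (ltn0Sn k) OS' OS SS.
  have [u Ou Eu] : congr_p 1 w (t (res w)) by apply/congruent_mod_pP.
  exists (v + u); first exact: integer_of_extD.
  transitivity ((S k.+1 ^+ q - S k ^+ q) + (S k ^+ q - S k)
     - p%:R ^+ k.+1 * t (res w)); first by rewrite /= DE; ring.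
  by rewrite Ev Ew -addrA -mulrBr Eu mulrA -exprD addn1 -mulrDr.
have [z Oz zP] := digits_limit d; exists z.
have zS k : congr_p k.+1 z (S k) by rewrite SE; apply: zP.
have res_z : res z = c.
  have [OS0 _] := SP 0%N; have [_ res_t] := tP c.
  by rewrite -res_t; apply/congruent_mod_pP.
have Ozq : O (z ^+ q - z).
  by apply: integer_of_extB => //; apply: integer_of_extX.
have zq : z ^+ q = z.
  (* The difference z^q - z lies in every p^k O, as z and z^q are close to S k and its q-th
     power. *)
  apply/eqP; rewrite -subr_eq0; apply/eqP/ideal_p_separated => // k.
  have [OS SS] := SP k.
  have zqS := congruent_mod_p_le (leqnSn _) (congruent_mod_pXq (ltn0Sn k) Oz OS (zS k)).
  have [w Ow Ew] := congruent_mod_pB zqS (zS k).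
  have [v Ov Ev] := SS.
  have : congr_p k.+1 (z ^+ q - z) 0.
    exists (w + v); first exact: integer_of_extD.
    by rewrite mulrDr -Ew -Ev; ring.
  by case/(congruent_mod_p_le (leqnSn k)) => u Ou; rewrite subr0; exists u.
split=> //.
have z_neq0 : z != 0 by apply: contraNneq c_neq0 => z0; rewrite -res_z z0 residue0.
by apply: (mulfI z_neq0); rewrite -exprS prednK // mulr1.
Qed.

End Digits.

Lemma integer_of_unity_root z k : (0 < k)%N -> z ^+ k = 1 -> O z.
Proof.
move=> k_gt0 zk1; exists ('X^k - 1); first exact: monicXnsubC.
by rewrite rmorphB rmorph1 /= map_polyXn /root !hornerE zk1 subrr.
Qed.

Let qpred_gt0 : (0 < q.-1)%N.
Proof. by have := finRing_gt1 F; case: q => [|[]]. Qed.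

(* z^(q-1) - 1 is z - 1 times a sum whose residue is q - 1 = -1 if z is
   congruent to 1. *)
Lemma unity_root_residue1 z : z ^+ q.-1 = 1 -> res z = 1 -> z = 1.
Proof.
move=> zq1 res_z; have Oz := integer_of_unity_root qpred_gt0 zq1.
have : (z - 1) * (\sum_(i < q.-1) z ^+ i) = 0.
  by rewrite -subrX1 zq1 subrr.
move/eqP; rewrite mulf_eq0 subr_eq0 => /orP[/eqP//|/eqP sum0].
have := congr1 res sum0; rewrite residue_sum_ext; last first.
  by move=> i _; apply: integer_of_extX.
under eq_bigr => i _ do rewrite residueX_ext // res_z expr1n.
rewrite sumr_const card_ord residue0 => q0.
have := card_residue_eq0; rewrite -[#|F|](@prednK _) ?(ltnW (finRing_gt1 F)) //.
by rewrite -natr1 q0 add0r => /eqP; rewrite oner_eq0.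
Qed.

Lemma unity_root_residue_inj z w : z ^+ q.-1 = 1 -> w ^+ q.-1 = 1 ->
  res z = res w -> z = w.
Proof.
move=> zq1 wq1 res_zw.
have Oz := integer_of_unity_root qpred_gt0 zq1.
have Ow := integer_of_unity_root qpred_gt0 wq1.
have w_neq0 : w != 0.
  by apply: contra_eqN wq1 => /eqP->; rewrite expr0n eqn0Ngt qpred_gt0 eq_sym oner_eq0.
have vq1 : w^-1 ^+ q.-1 = 1 by rewrite exprVn wq1 invr1.
have Ov := integer_of_unity_root qpred_gt0 vq1.
apply: (mulIf (invr_neq0 w_neq0)); rewrite mulfV //.
apply: unity_root_residue1; first by rewrite exprMn zq1 vq1 mulr1.
by rewrite residueM_ext // res_zw -residueM_ext // mulfV // residue1.
Qed.

Lemma teichmullerP c : c != 0 ->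
  teichmuller res c ^+ q.-1 = 1 /\ res (teichmuller res c) = c.
Proof.
move=> c_neq0; rewrite /teichmuller (negPf c_neq0).
have [t tP] := residue_lift.
have [z [_ zq1 res_z]] := teichmuller_lift tP c_neq0.
by apply: (@xgetPex _ 0 [set z | z ^+ q.-1 = 1 /\ res z = c]%classic); exists z.
Qed.

Lemma teichmullerM c c' :
  teichmuller res (c * c') = teichmuller res c * teichmuller res c'.
Proof.
have [->|c_neq0] := eqVneq c 0; first by rewrite /teichmuller mul0r eqxx mul0r.
have [->|c'_neq0] := eqVneq c' 0; first by rewrite /teichmuller mulr0 eqxx mulr0.
have [cq1 res_c] := teichmullerP c_neq0; have [c'q1 res_c'] := teichmullerP c'_neq0.
have [ccq1 res_cc] := teichmullerP (mulf_neq0 c_neq0 c'_neq0).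
apply: unity_root_residue_inj; rewrite ?exprMn ?cq1 ?c'q1 ?mulr1 //.
rewrite res_cc residueM_ext ?res_c ?res_c' //.
all: by apply: (@integer_of_unity_root _ q.-1).
Qed.

Lemma teichmuller_neq0 c : c != 0 -> teichmuller res c != 0.
Proof.
case/teichmullerP => cq1 _; apply: contra_eqN cq1 => /eqP->.
by rewrite expr0n eqn0Ngt qpred_gt0 eq_sym oner_eq0.
Qed.

Lemma teichmuller1 : teichmuller res 1 = 1.
Proof.
apply: (mulfI (teichmuller_neq0 (oner_neq0 _))).
by rewrite -teichmullerM !mulr1.
Qed.

Lemma teichmullerX c k : teichmuller res (c ^+ k) = teichmuller res c ^+ k.
Proof.
elim: k => [|k IHk]; first exact: teichmuller1.
by rewrite !exprS teichmullerM IHk.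
Qed.

Local Notation bar := (teichmuller_bar_exp res).

Lemma teichmuller_bar_periodic j c : bar (j + q.-1) c = bar j c.
Proof.
rewrite /teichmuller_bar_exp; case: eqP => // /eqP /teichmullerP[cq1 _].
by rewrite exprD [_ ^+ q.-1]exprVn cq1 invr1 mulr1.
Qed.

Lemma teichmuller_bar_power j n c : (0 < n)%N -> bar j (c ^+ n) = bar (n * j) c.
Proof.
move=> n_gt0; rewrite /teichmuller_bar_exp expf_eq0 n_gt0 /=.
by case: eqP => // _; rewrite teichmullerX -exprVn -exprM.
Qed.

(** Orthogonality: the inverse of omega(zeta)^j is an n-th root of unity, equal to 1 exactly when n
    divides j because omega is injective, and its geometric sum is n or 0. At c = 0 every term
    vanishes, even for j = 0. *)
Lemma teichmuller_bar_sum n zeta j c : n.-primitive_root zeta ->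
  \sum_(l < n) bar j (zeta ^+ l * c)
  = if (n %| j)%N then n%:R * bar j c else 0.
Proof.
move=> prim; have n_gt0 := prim_order_gt0 prim.
have zeta_neq0 : zeta != 0.
  by rewrite (prim_root_eq0 prim) -lt0n.
have [->|c_neq0] := eqVneq c 0.
  rewrite big1 => [|l _]; rewrite /teichmuller_bar_exp ?mulr0 eqxx //.
  by rewrite mulr0 if_same.
have [zq1 res_z] := teichmullerP zeta_neq0.
have -> : \sum_(l < n) bar j (zeta ^+ l * c)
    = (\sum_(l < n) ((teichmuller res zeta)^-1 ^+ j) ^+ l) * bar j c.
  rewrite mulr_suml; apply: eq_bigr => l _.
  rewrite /teichmuller_bar_exp mulf_eq0 (negPf c_neq0) expf_eq0.
  rewrite (negPf zeta_neq0) andbF /= teichmullerM teichmullerX invfM exprMn.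
  by rewrite -!exprVn -!exprM [(j * l)%N]mulnC.
set eta := _^-1 ^+ j.
have eta_n : eta ^+ n = 1.
  rewrite /eta -exprM mulnC exprM exprVn -teichmullerX (prim_expr_order prim).
  by rewrite teichmuller1 invr1 expr1n.
have eta1 : (eta == 1) = (n %| j)%N.
  rewrite (prim_order_dvd prim) /eta exprVn invr_eq1 -teichmullerX.
  apply/eqP/eqP => [E|->]; last exact: teichmuller1.
  have [_ <-] := teichmullerP (expf_neq0 j zeta_neq0).
  by rewrite E residue1.
case: ifP => dvd; rewrite dvd in eta1.
  move/eqP: eta1 => ->; under eq_bigr do rewrite expr1n.
  by rewrite sumr_const card_ord.
have : (eta - 1) * (\sum_(l < n) eta ^+ l) = 0.
  by rewrite -subrX1 eta_n subrr.
by move/eqP; rewrite mulf_eq0 subr_eq0 eta1 => /eqP->; rewrite mul0r.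
Qed.

End Teichmuller.

(** * Telescoping sums of fractional parts *)

Section TelescopingFractionalParts.
Variables (p : nat) (p_pr : prime p) (N : nat) (N_gt0 : (0 < N)%N).
Local Notation W := (p ^ N - 1)%N.
Local Notation frac_p m u := (fracpart ((p ^ m)%:R * u)).
Implicit Types u v c : rat.

Let W_dvd m : (W %| p ^ (N * m) - 1)%N.
Proof.
by rewrite expnM; apply/dvdnP; exists (\sum_(i < m) (p ^ N) ^ i)%N;
  rewrite mulnC !subn1 predn_exp.
Qed.

Let p_gt0 m : (0 < p ^ m)%N.
Proof. by rewrite expn_gt0 prime_gt0. Qed.

Lemma int_expn_periodic m u : W%:R * u \is a Num.int ->
  (p ^ (N * m))%:R * u - u \is a Num.int.
Proof.
move=> Wu; have /dvdnP[c Ec] := W_dvd m.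
have -> : (p ^ (N * m))%:R * u - u = c%:R * (W%:R * u).
  by rewrite mulrA -natrM -Ec natrB //; ring.
by apply: rpredM; rewrite ?natr_int.
Qed.

Lemma frac_p_periodic m u : W%:R * u \is a Num.int ->
  frac_p (N + m) u = frac_p m u.
Proof.
move=> Wu; apply: fracpart_eq.
have -> : (p ^ (N + m))%:R * u - (p ^ m)%:R * u
    = (p ^ m)%:R * ((p ^ (N * 1))%:R * u - u).
  by rewrite muln1 expnD natrM; ring.
by apply: rpredM; rewrite ?natr_int ?int_expn_periodic.
Qed.

Lemma frac_pD m k u : frac_p m (frac_p k u) = frac_p (m + k) u.
Proof.
rewrite -[_ * fracpart _]addr0 pmulrn fracpart_fracpartMD -pmulrn addr0.
by rewrite mulrA -natrM -expnD.
Qed.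

(** By periodicity the j-th fractional part is the one of index N - 1 + (j + 1), and the term
    subtracted from it has index N - 1 + j. *)
Lemma frac_p_telescope k u : W%:R * u \is a Num.int ->
  \sum_(j < k) (frac_p j u - frac_p N.-1 (frac_p j u))
  = frac_p (N.-1 + k) u - frac_p N.-1 u.
Proof.
move=> Wu; have := telescope_sumr (fun j => frac_p (N.-1 + j) u) (leq0n k).
rewrite addn0 => <-; rewrite big_mkord; apply: eq_bigr => j _.
by rewrite frac_pD addnS -addSn prednK // frac_p_periodic.
Qed.

Lemma frac_p_int m u : W%:R * u \is a Num.int ->
  ((p ^ m)%:R * u \is a Num.int) = (u \is a Num.int).
Proof.
move=> Wu; apply/idP/idP => [pu|Zu]; last by rewrite rpredM ?natr_int.
have -> : u = (p ^ (N * m - m))%:R * ((p ^ m)%:R * u)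
    - ((p ^ (N * m))%:R * u - u).
  by rewrite mulrA -natrM -expnD subnK ?leq_pmull //; ring.
by apply: rpredB; [apply: rpredM|]; rewrite ?natr_int ?int_expn_periodic.
Qed.

(** The fractional parts of x and -x add up to 0 or 1 according to whether x is an integer, and
    whether p^m u is an integer does not depend on m. *)
Lemma frac_p_increment_opp m k u : W%:R * u \is a Num.int ->
  frac_p m (- u) - frac_p k (- u) = frac_p k u - frac_p m u.
Proof.
by move=> Wu; rewrite !mulrN !fracpartN !frac_p_int //; ring.
Qed.

Variables (R : realType) (r : nat) (I : finType) (alpha beta : I -> rat).
Variables (P Q : seq nat).
Hypothesis eqPQ : exponents_eq R alpha beta P Q.
Hypothesis alphaW : forall i, W%:R * alpha i \is a Num.int.
Hypothesis betaW : forall i, W%:R * beta i \is a Num.int.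
Variable c : rat.
Hypothesis cW : W%:R * c \is a Num.int.
Hypothesis c_q : (p ^ r)%:R * c - c \is a Num.int.

(** The balance condition of [gamma_prod_ratio]. The difference of the sides telescopes in k; as p^r
    c - c is an integer, there remains the sum of g(p^r y) - g(y) over the alpha minus that over the
    beta, with g defined modulo 1. It vanishes by [exponents_eq_mulr] for s = p^r. *)
Lemma sum_frac_p_pred :
  \sum_i \sum_(k < r)
    ((frac_p k (alpha i - c) - frac_p k (alpha i))
     + (frac_p k (- beta i + c) - frac_p k (- beta i)))
  = \sum_i \sum_(k < r)
    ((frac_p N.-1 (frac_p k (alpha i - c)) - frac_p N.-1 (frac_p k (alpha i)))
     + (frac_p N.-1 (frac_p k (- beta i + c))
        - frac_p N.-1 (frac_p k (- beta i)))).
Proof.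
have WB u v : W%:R * u \is a Num.int -> W%:R * v \is a Num.int ->
    W%:R * (u - v) \is a Num.int by move=> Wu Wv; rewrite mulrBr rpredB.
pose g y := frac_p N.-1 (y - c) - frac_p N.-1 y.
have gE y : g (frac_p r y) - g (fracpart y)
   = (frac_p (N.-1 + r) (y - c) - frac_p N.-1 (y - c))
     - (frac_p (N.-1 + r) y - frac_p N.-1 y).
  have gf x : g (fracpart x) = frac_p N.-1 (x - c) - frac_p N.-1 x.
    rewrite /g mulrBr pmulrn fracpart_fracpartMD -mulrBr -pmulrn.
    by rewrite -[_ * fracpart _]addr0 pmulrn fracpart_fracpartMD -pmulrn addr0.
  rewrite !gf; have -> : frac_p N.-1 ((p ^ r)%:R * y - c)
      = frac_p (N.-1 + r) (y - c).
    apply: fracpart_eq.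
    have -> : (p ^ N.-1)%:R * ((p ^ r)%:R * y - c) - (p ^ (N.-1 + r))%:R * (y - c)
       = (p ^ N.-1)%:R * ((p ^ r)%:R * c - c) by rewrite expnD natrM; ring.
    by apply: rpredM; rewrite ?natr_int.
  by rewrite mulrA -natrM -expnD; ring.
(* Since p^(N r) = 1 modulo W, p^(N r - r) is an inverse of p^r. *)
have ss' : (p ^ r * p ^ (N * r - r) = 1 %[mod W])%N.
  rewrite -expnD subnKC ?leq_pmull //; apply/eqP.
  by rewrite eqn_mod_dvd ?W_dvd.
have gsum : \sum_i (g (frac_p r (alpha i)) - g (fracpart (alpha i)))
    = \sum_i (g (frac_p r (beta i)) - g (fracpart (beta i))).
  have := exponents_eq_mulr ss' eqPQ alphaW betaW.
  set s1 := _ ++ _; set s2 := _ ++ _ => perm12.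
  have : \sum_(x <- s1) g x = \sum_(x <- s2) g x by apply: perm_big.
  rewrite !big_cat /= !big_map -!enumT !big_enum /= => E.
  have cross (x y z t : rat) : x + y = z + t -> x - z = t - y by lra.
  by rewrite [LHS]sumrB [RHS]sumrB; apply: cross E.
apply/eqP; rewrite -subr_eq0 -sumrB; apply/eqP.
pose D u := frac_p (N.-1 + r) u - frac_p N.-1 u.
transitivity (\sum_i ((D (alpha i - c) - D (alpha i))
                      - (D (beta i - c) - D (beta i)))).
  apply: eq_bigr => i _; rewrite -sumrB.
  (* Increments are odd, so the terms in -beta become those in beta with the opposite sign. *)
  have -> : D (alpha i - c) - D (alpha i) - (D (beta i - c) - D (beta i))
     = D (alpha i - c) - D (alpha i) + (D (- beta i + c) - D (- beta i)).
    have := frac_p_increment_opp (N.-1 + r) N.-1 (betaW i).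
    have := frac_p_increment_opp (N.-1 + r) N.-1 (WB _ _ (betaW i) cW).
    by rewrite opprB [c - _]addrC /D => -> ->; ring.
  rewrite /D -!frac_p_telescope ?WB //.
    by rewrite -!sumrB -big_split /=; apply: eq_bigr => k _; ring.
  - by rewrite mulrN rpredN.
  - by rewrite addrC WB.
rewrite sumrB; apply/eqP; rewrite subr_eq0; apply/eqP.
by under eq_bigr do rewrite -gE; under [RHS]eq_bigr do rewrite -gE.
Qed.

Lemma sum_frac_p_int :
  \sum_i \sum_(k < r)
    ((frac_p k (alpha i - c) - frac_p k (alpha i))
     + (frac_p k (- beta i + c) - frac_p k (- beta i))) \is a Num.int.
Proof.
apply: rpred_sum => i _; apply: rpred_sum => k _.
set x1 := (p ^ k)%:R * (alpha i - c); set x2 := (p ^ k)%:R * alpha i.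
set x3 := (p ^ k)%:R * (- beta i + c); set x4 := (p ^ k)%:R * - beta i.
have -> : fracpart x1 - fracpart x2 + (fracpart x3 - fracpart x4)
   = (fracpart x1 - x1) - (fracpart x2 - x2)
     + ((fracpart x3 - x3) - (fracpart x4 - x4)).
  have : x1 - x2 + (x3 - x4) = 0 by rewrite /x1 /x2 /x3 /x4; ring.
  by lra.
by apply: rpredD; apply: rpredB; apply: fracpart_subr_int.
Qed.

End TelescopingFractionalParts.

(** * Coefficients of the hypergeometric series *)

Section Coefficients.
Variables (p : nat) (p_pr : prime p) (p_odd : odd p) (r : nat).
Variables (K : fieldType) (gam : rat -> K) (w : K).
Local Notation q := (p ^ r)%N.

(** The functions [gam] and the element [w] stand for Gamma_p and -p: periodicity and grouping
    involve only fractional parts and floors. *)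
Definition mGm_coeff (I : finType) (a b : I -> rat) (j : nat) : K :=
  let c : rat := j%:R / (q - 1)%:R in
  (-1) ^+ (j * #|I|) *
  \prod_(i : I) \prod_(k < r)
    (gam (fracpart ((a i - c) * p%:R ^+ k)) / gam (fracpart (a i * p%:R ^+ k))
     * (gam (fracpart ((- b i + c) * p%:R ^+ k))
        / gam (fracpart (- b i * p%:R ^+ k)))
     * w ^ (- Num.floor (fracpart (a i * p%:R ^+ k) - c * p%:R ^+ k)
            - Num.floor (fracpart (- b i * p%:R ^+ k) + c * p%:R ^+ k))).

Hypothesis r_gt0 : (0 < r)%N.

Let q_gt1 : (1 < q)%N.
Proof. by rewrite -(expn0 p) ltn_exp2l ?prime_gt1. Qed.

Let q1_neq0 : (q - 1)%:R != 0 :> rat.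
Proof. by rewrite pnatr_eq0 subn_eq0 -ltnNge. Qed.

(** Here c grows by 1: the fractional parts stay, the two floors change by opposite integers, and
    the sign stays because q - 1 is even. *)
Lemma mGm_coeff_periodic (I : finType) (a b : I -> rat) j :
  mGm_coeff a b (j + (q - 1)) = mGm_coeff a b j.
Proof.
rewrite /mGm_coeff; set c : rat := j%:R / _.
have -> : (j + (q - 1))%:R / (q - 1)%:R = c + 1 by rewrite natrD mulrDl mulfV.
congr (_ * _).
  have odd_q1 : odd (q - 1) = false.
    by rewrite oddB ?(ltnW q_gt1) // oddX p_odd orbT.
  rewrite -(signr_odd K (_ * _)) -(signr_odd K (j * _)).
  by rewrite !oddM oddD odd_q1 addbF.
apply: eq_bigr => i _; apply: eq_bigr => k _.
set pk := p%:R ^+ k; have pk_int : pk \is a Num.int by rewrite rpredX ?natr_int.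
have fr x y : x - y = pk \/ y - x = pk -> fracpart x = fracpart y.
  case=> xy; first by apply: fracpart_eq; rewrite xy.
  by apply/esym/fracpart_eq; rewrite xy.
congr (_ / _ * (_ / _) * _ ^ _); try congr (gam _).
- by apply: fr; right; ring.
- by apply: fr; left; ring.
have -> : fracpart (a i * pk) - (c + 1) * pk = (fracpart (a i * pk) - c * pk) - pk.
  by ring.
have -> : fracpart (- b i * pk) + (c + 1) * pk
   = (fracpart (- b i * pk) + c * pk) + pk by ring.
have /intrP[z ->] := pk_int; rewrite -(rmorphN (intmul 1)) /=.
rewrite (floorDrz _ (intr_int _ (- z))) (floorDrz _ (intr_int _ z)).
by rewrite !intrKfloor; ring.
Qed.

Hypothesis w_neq0 : w != 0.
Variables (n : nat) (n_gt0 : (0 < n)%N) (co_pn : coprime p n).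

Let n_neq0 : n%:R != 0 :> rat.
Proof. by rewrite pnatr_eq0 -lt0n. Qed.

Let co_nX k : coprimez n ((p ^ k)%N : int).
Proof. by rewrite coprimezE /= coprime_sym coprimeXl. Qed.

Let co_nXN k : coprimez n (- ((p ^ k)%N : int)).
Proof. by rewrite coprimezE abszN /= coprime_sym coprimeXl. Qed.

(* Grouping the n parameters lifting n a and n b turns each Gamma_p(z) into the
   product gam_n(z) of the Gamma_p((z + h)/n). *)
Let gam_n z : K := \prod_(h < n) gam ((z + h%:R) / n%:R).

(** As p is prime to n, the shifts by l p^k / n, or their opposites for the b, run over all l/n
    modulo 1. Floors add up by Hermite's identity, and the signs agree since there are n m
    parameters. *)
Lemma mGm_coeff_group (m : nat) (a b : 'I_m -> rat) j :
  let a_shift (il : 'I_m * 'I_n) := a il.1 + il.2%:R / n%:R in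
  let b_shift (il : 'I_m * 'I_n) := b il.1 + il.2%:R / n%:R in
  let na i := n%:R * a i in let nb i := n%:R * b i in
  let c : rat := (n * j)%:R / (q - 1)%:R in
  mGm_coeff a_shift b_shift j = (-1) ^+ (n * j * #|'I_m|) *
  \prod_(i < m) \prod_(k < r)
    (gam_n (fracpart ((na i - c) * p%:R ^+ k)) / gam_n (fracpart (na i * p%:R ^+ k))
     * (gam_n (fracpart ((- nb i + c) * p%:R ^+ k))
        / gam_n (fracpart (- nb i * p%:R ^+ k)))
     * w ^ (- Num.floor (fracpart (na i * p%:R ^+ k) - c * p%:R ^+ k)
                   - Num.floor (fracpart (- nb i * p%:R ^+ k) + c * p%:R ^+ k))).
Proof.
move=> a_shift b_shift na nb c; rewrite /mGm_coeff.
set d : rat := j%:R / (q - 1)%:R.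
have cE : c = n%:R * d by rewrite /c natrM mulrA.
rewrite card_prod !card_ord; congr (_ ^+ _ * _).
  by rewrite [(n * j)%N]mulnC -mulnA [(n * m)%N]mulnC.
have pairE (f : 'I_m * 'I_n -> K) : \prod_il f il = \prod_i \prod_l f (i, l).
  by rewrite pair_bigA; apply: eq_bigr => -[].
rewrite pairE; apply: eq_bigr => i _.
rewrite exchange_big; apply: eq_bigr => k _ /=.
have posP : (p ^ k)%N%:Z%:~R = p%:R ^+ k :> rat by rewrite -pmulrn natrX.
have negP : (- ((p ^ k)%N : int))%:~R = - p%:R ^+ k :> rat by rewrite mulrNz posP.
have group_p (f : rat -> K) (x : rat) (y : 'I_n -> rat) z :
    (forall l, y l = x + l%:R / n%:R * p%:R ^+ k) -> z = n%:R * x ->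
    \prod_(l < n) f (fracpart (y l))
      = \prod_(h < n) f ((fracpart z + h%:R) / n%:R).
  move=> yE ->; rewrite -(big_fracpart_shift _ _ _ n_gt0 (co_nX k)).
  by apply: eq_bigr => l _; rewrite yE posP.
have group_n (f : rat -> K) (x : rat) (y : 'I_n -> rat) z :
    (forall l, y l = x - l%:R / n%:R * p%:R ^+ k) -> z = n%:R * x ->
    \prod_(l < n) f (fracpart (y l))
      = \prod_(h < n) f ((fracpart z + h%:R) / n%:R).
  move=> yE ->; rewrite -(big_fracpart_shift _ _ _ n_gt0 (co_nXN k)).
  by apply: eq_bigr => l _; rewrite yE negP mulrN.
have wX_prod (e : 'I_n -> int) : \prod_(l < n) w ^ e l = w ^ (\sum_(l < n) e l).
  by elim/big_rec2: _ => [|l x y _ ->]; rewrite ?expr0z // expfzDr.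
have sum_floor (s : int) (x t z : rat) (y : 'I_n -> rat) : coprimez n s ->
    (forall l, y l = x + l%:R / n%:R * s%:~R) -> z = n%:R * x ->
    \sum_(l < n) Num.floor (fracpart (y l) - t)
      = Num.floor (fracpart z - n%:R * t).
  move=> co_s yE ->; rewrite -sum_floor_shift //.
  rewrite -(big_fracpart_shift _ (fun z => Num.floor (z - t)) _ n_gt0 co_s).
  by apply: eq_bigr => l _; rewrite yE.
rewrite big_split /= wX_prod sumrB !sumrN; congr (_ * _ ^ (- _ - _)).
- rewrite !big_split /= !prodfV; congr (_ / _ * (_ / _)).
  + by apply: (group_p _ ((a i - d) * p%:R ^+ k)) => [l|];
      rewrite ?cE /a_shift /na /=; ring.
  + by apply: (group_p _ (a i * p%:R ^+ k)) => [l|];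
      rewrite /a_shift /na /=; ring.
  + by apply: (group_n _ ((- b i + d) * p%:R ^+ k)) => [l|];
      rewrite ?cE /b_shift /nb /=; ring.
  + by apply: (group_n _ (- b i * p%:R ^+ k)) => [l|];
      rewrite /b_shift /nb /=; ring.
- rewrite (sum_floor _ (a i * p%:R ^+ k) _ (na i * p%:R ^+ k) _ (co_nX k)).
  + by rewrite cE mulrA.
  + by move=> l; rewrite posP /a_shift /=; ring.
  + by rewrite /na; ring.
(* Written to match the form x - n t of Hermite's identity, with t = - d p^k. *)
have -> : c * p%:R ^+ k = - (n%:R * - (d * p%:R ^+ k)) by rewrite cE; ring.
rewrite -(sum_floor _ (- b i * p%:R ^+ k) _ (- nb i * p%:R ^+ k)
  (fun l => - (b i + l%:R / n%:R) * p%:R ^+ k) (co_nXN k)).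
+ by apply: eq_bigr => l _; rewrite opprK.
+ by move=> l; rewrite negP; ring.
+ by rewrite /nb; ring.
Qed.

Lemma mGm_coeff0 (I : finType) (a b : I -> rat) j (i0 : I) :
  (forall x, gam x = 0) -> mGm_coeff a b j = 0.
Proof.
move=> gam0; rewrite /mGm_coeff (bigD1 i0) //= (bigD1 (Ordinal r_gt0)) //=.
by rewrite !gam0 !mul0r !mulr0.
Qed.

Lemma mGm_coeff_shift (m : nat) (a b : 'I_m -> rat) j :
  let a_shift (il : 'I_m * 'I_n) := a il.1 + il.2%:R / n%:R in
  let b_shift (il : 'I_m * 'I_n) := b il.1 + il.2%:R / n%:R in
  let na i := n%:R * a i in let nb i := n%:R * b i in
  let c : rat := (n * j)%:R / (q - 1)%:R in
  let ratio (f : rat -> K) := \prod_(i < m) \prod_(k < r)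
    (f (fracpart ((na i - c) * p%:R ^+ k)) / f (fracpart (na i * p%:R ^+ k))
     * (f (fracpart ((- nb i + c) * p%:R ^+ k))
        / f (fracpart (- nb i * p%:R ^+ k)))) in
  ratio (fun z => \prod_(h < n) gam ((z + h%:R) / n%:R)) = ratio gam ->
  mGm_coeff a_shift b_shift j = mGm_coeff na nb (n * j).
Proof.
move=> a_shift b_shift na nb c ratio ratioE; rewrite mGm_coeff_group.
rewrite /mGm_coeff; congr (_ * _).
have split2 (f g : 'I_m -> 'I_r -> K) : \prod_i \prod_k (f i k * g i k)
    = \prod_i \prod_k f i k * \prod_i \prod_k g i k.
  by under eq_bigr do rewrite big_split; rewrite big_split.
by rewrite [LHS]split2 [RHS]split2; congr (_ * _); apply: ratioE.
Qed.

End Coefficients.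

(** Returns from the cross-multiplied identity to quotients. The Boolean merges z1 over z2 and z3
    over z4 into a single family. *)
Lemma prod_cross_ratio (K : fieldType) (I J : finType) (g : rat -> K) (n : nat)
    (z1 z2 z3 z4 : I -> J -> rat) :
  (forall x, g x != 0) ->
  let f z := \prod_(h < n) g ((z + h%:R) / n%:R) in
  let zn (t : (I * J) * bool) :=
    if t.2 then z1 t.1.1 t.1.2 else z3 t.1.1 t.1.2 in
  let zd (t : (I * J) * bool) :=
    if t.2 then z2 t.1.1 t.1.2 else z4 t.1.1 t.1.2 in
  \prod_t (f (zn t) * g (zd t)) = \prod_t (f (zd t) * g (zn t)) ->
  \prod_i \prod_k (f (z1 i k) / f (z2 i k) * (f (z3 i k) / f (z4 i k)))
  = \prod_i \prod_k (g (z1 i k) / g (z2 i k) * (g (z3 i k) / g (z4 i k))).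
Proof.
move=> g_neq0 f zn zd.
have f_neq0 x : f x != 0 by apply/prodf_neq0.
have ratioE (h : rat -> K) :
    \prod_i \prod_k (h (z1 i k) / h (z2 i k) * (h (z3 i k) / h (z4 i k)))
    = \prod_t h (zn t) / \prod_t h (zd t).
  rewrite -prodf_div pair_bigA /=.
  have -> : \prod_t (h (zn t) / h (zd t))
      = \prod_(ik : I * J) \prod_(b : bool) (h (zn (ik, b)) / h (zd (ik, b))).
    by rewrite pair_bigA; apply: eq_bigr => -[].
  by apply: eq_bigr => ik _; rewrite big_bool.
have prod_neq0 (h : rat -> K) (z : (I * J) * bool -> rat) :
    (forall x, h x != 0) -> \prod_t h (z t) != 0.
  by move=> h_neq0; apply/prodf_neq0.
rewrite !ratioE !big_split /= => E; apply/eqP.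
by rewrite eqr_div ?prod_neq0 // E mulrC.
Qed.

(** The function sending j to f (n j) has period N, and s N indices cover s periods. *)
Lemma sum_periodic_mul (V : zmodType) (f : nat -> V) (n N s : nat) :
  (forall j, f (j + n * N)%N = f j) ->
  \sum_(j < s * N) f (n * j)%N = (\sum_(j < N) f (n * j)%N) *+ s.
Proof.
move=> f_per; elim: s => [|s IHs]; first by rewrite mul0n big_ord0 mulr0n.
have per i k : f (n * (i * N + k))%N = f (n * k)%N.
  elim: i => [|i IHi]; first by rewrite mul0n.
  by rewrite mulSn -addnA addnC mulnDr f_per.
rewrite mulSnr big_split_ord /= IHs mulrSr; congr (_ + _).
by apply: eq_bigr => k _; rewrite per.
Qed.
Lemma sum_multiples (V : zmodType) (f : nat -> V) (n N : nat) : (0 < n)%N ->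
  \sum_(j < n * N) (if (n %| j)%N then f j else 0) = \sum_(j < N) f (n * j)%N.
Proof.
move=> n_gt0; elim: N => [|N IHN]; first by rewrite muln0 !big_ord0.
rewrite mulnSr big_split_ord /= IHN big_ord_recr /=; congr (_ + _).
(* The last block of n consecutive indices contains one multiple of n, its first element. *)
case: n n_gt0 {IHN} => // n _; rewrite big_ord_recl /= addn0 dvdn_mulr //.
rewrite big1 ?addr0 // => i _; case: ifP => //.
by rewrite dvdn_addr ?dvdn_mulr // gtnNdvd //= /bump add1n ltnS.
Qed.

(** * Gamma quotients for parameters defined over Q *)

Section GammaRat.
Variables (p : nat) (p_pr : prime p).
Hypothesis G_spec : morita_gamma_spec (@padic_gamma p p_pr).
Local Notation gam := (gamma_rat p_pr).

Lemma gamma_rat_neq0 x : gam x != 0.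
Proof. by rewrite tofrac_eq0 gamma_neq0. Qed.

Lemma ratr_shift_div (n h : nat) x : (0 < n)%N -> coprime p n ->
  padic_integral p x ->
  ratr ((x + h%:R) / n%:R) = (ratr x + h%:R) / n%:R :> padic_int p_pr.
Proof.
move=> n_gt0 co_pn x_int; have n_neq0 : n%:R != 0 :> rat by rewrite pnatr_eq0 -lt0n.
have h_int : padic_integral p h%:R by apply/padic_integral_int/natr_int.
have n_int : padic_integral p n%:R^-1.
  by apply: (padic_integral_intr co_pn); rewrite mulfV.
rewrite padic_ratrM ?padic_ratrD ?ratr_nat //; last exact: padic_integralD.
congr (_ * _); symmetry; apply: (@ratr_eq _ _ _ _ n 1) => //.
- by rewrite -lt0n.
- by rewrite -pmulrn mulfV.
- by rewrite -pmulrn mulrV // padic_natr_unit.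
Qed.

Variables (R : realType) (r : nat) (n : nat) (n_gt0 : (0 < n)%N).
Hypothesis co_pn : coprime p n.
Variables (I : finType) (alpha beta : I -> rat) (c : rat).
Hypothesis alpha_int : forall i, padic_integral p (alpha i).
Hypothesis beta_int : forall i, padic_integral p (beta i).
Hypothesis c_int : (p ^ r - 1)%:R * c \is a Num.int.
Hypothesis r_gt0 : (0 < r)%N.
Hypothesis def_Q : defined_over_Q R alpha beta.

Let p_gt0 m : (0 < p ^ m)%N.
Proof. by rewrite expn_gt0 prime_gt0. Qed.

(** The denominators and p^r - 1 are prime to p, so their product D divides p^N - 1 for N = phi(D),
    by Euler's theorem. *)
Let common_period : exists2 N, (0 < N)%N &
  [/\ forall i, (p ^ N - 1)%:R * alpha i \is a Num.int,
      forall i, (p ^ N - 1)%:R * beta i \is a Num.int &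
      (p ^ N - 1)%:R * c \is a Num.int].
Proof.
pose D := ((\prod_i `|denq (alpha i)|) * (\prod_i `|denq (beta i)|) * (p ^ r - 1))%N.
have co_pD : coprime p D.
  have co_q : coprime p (p ^ r - 1).
    by rewrite -(coprime_pexpl _ _ r_gt0) subn1 coprimenP ?p_gt0.
  have co_prod (z : I -> rat) : (forall i, padic_integral p (z i)) ->
      coprime p (\prod_i `|denq (z i)|).
    move=> z_int; elim/big_ind: _ => [|x y|i _]; rewrite ?coprimen1 //.
      by rewrite coprimeMr => -> ->.
    exact: z_int.
  by rewrite !coprimeMr co_q !co_prod.
have D_gt0 : (0 < D)%N.
  case: (D) co_pD => //; rewrite /coprime gcdn0 => /eqP p1.
  by have := prime_gt1 p_pr; rewrite p1.
exists (totient D); first by rewrite totient_gt0.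
have /dvdnP[e De] : (D %| p ^ totient D - 1)%N.
  by rewrite -eqn_mod_dvd ?p_gt0 //; apply/eqP/Euler_exp_totient.
have dint (d : nat) (x : rat) : (d %| D)%N -> d%:R * x \is a Num.int ->
    (p ^ totient D - 1)%:R * x \is a Num.int.
  move=> /dvdnP[k Dk] dx; rewrite De Dk !natrM -!mulrA.
  by apply: rpredM; [|apply: rpredM]; rewrite ?natr_int.
have denE (x : rat) : (`|denq x|%N)%:R * x \is a Num.int.
  by rewrite pmulrn absz_denq mulrC -{1}[x]divq_num_den divfK ?intr_int //
     intr_eq0 denq_neq0.
have den_dvd (z : I -> rat) i : (`|denq (z i)| %| \prod_i0 `|denq (z i0)|)%N.
  by rewrite (bigD1 i) //= dvdn_mulr.
split=> [i|i|].
- apply: (dint `|denq (alpha i)|%N) => //.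
  by rewrite /D dvdn_mulr // dvdn_mulr // den_dvd.
- apply: (dint `|denq (beta i)|%N) => //.
  by rewrite /D dvdn_mulr // dvdn_mull // den_dvd.
- by apply: (dint (p ^ r - 1)%N) => //; rewrite /D dvdn_mull.
Qed.

(** An instance of [gamma_prod_ratio], carried from Z_p to Q_p: the numerators form [zn], the
    denominators [zd], and the telescoping sums supply the two balance conditions. *)
Lemma gamma_cross_ratio :
  let ratio (f : rat -> 'Qp p_pr) := \prod_i \prod_(k < r)
    (f (fracpart ((alpha i - c) * p%:R ^+ k)) / f (fracpart (alpha i * p%:R ^+ k))
     * (f (fracpart ((- beta i + c) * p%:R ^+ k))
        / f (fracpart (- beta i * p%:R ^+ k)))) in
  ratio (fun z => \prod_(h < n) gam ((z + h%:R) / n%:R)) = ratio gam.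
Proof.
have [N N_gt0 [alphaW betaW cW]] := common_period.
have [P [Q [eqPQ _]]] := def_Q.
have c_q : (p ^ r)%:R * c - c \is a Num.int.
  by move: c_int; rewrite natrB // mulrBl mul1r.
have sum_int := sum_frac_p_int p r alpha beta c.
have sum_pred := sum_frac_p_pred p_pr N_gt0 eqPQ alphaW betaW cW c_q.
have W_int x y : (p ^ N - 1)%:R * x \is a Num.int ->
    (p ^ N - 1)%:R * y \is a Num.int -> (p ^ N - 1)%:R * (x + y) \is a Num.int.
  by move=> Wx Wy; rewrite mulrDr rpredD.
have WN x : (p ^ N - 1)%:R * x \is a Num.int ->
    (p ^ N - 1)%:R * - x \is a Num.int by rewrite mulrN rpredN.
have WF k x : (p ^ N - 1)%:R * x \is a Num.int ->
    (p ^ N - 1)%:R * fracpart ((p ^ k)%:R * x) \is a Num.int.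
  move=> Wx; have -> : (p ^ N - 1)%:R * fracpart ((p ^ k)%:R * x)
      = (p ^ N - 1)%:R * (fracpart ((p ^ k)%:R * x) - (p ^ k)%:R * x)
        + (p ^ k)%:R * ((p ^ N - 1)%:R * x) by ring.
  by apply: rpredD; apply: rpredM; rewrite ?natr_int ?fracpart_subr_int.
move=> ratio.
have mulpX (x : rat) k : x * p%:R ^+ k = (p ^ k)%:R * x by rewrite natrX mulrC.
pose zn (t : (I * 'I_r) * bool) : rat :=
  if t.2 then fracpart ((alpha t.1.1 - c) * p%:R ^+ t.1.2)
  else fracpart ((- beta t.1.1 + c) * p%:R ^+ t.1.2).
pose zd (t : (I * 'I_r) * bool) : rat :=
  if t.2 then fracpart (alpha t.1.1 * p%:R ^+ t.1.2)
  else fracpart (- beta t.1.1 * p%:R ^+ t.1.2).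
suff cross : \prod_t ((\prod_(h < n) gam ((zn t + h%:R) / n%:R)) * gam (zd t))
    = \prod_t ((\prod_(h < n) gam ((zd t + h%:R) / n%:R)) * gam (zn t)).
  by apply: prod_cross_ratio cross => x; apply: gamma_rat_neq0.
have znE t : zn t = if t.2 then fracpart ((p ^ t.1.2)%:R * (alpha t.1.1 - c))
    else fracpart ((p ^ t.1.2)%:R * (- beta t.1.1 + c)).
  by rewrite /zn !mulpX.
have zdE t : zd t = if t.2 then fracpart ((p ^ t.1.2)%:R * alpha t.1.1)
    else fracpart ((p ^ t.1.2)%:R * - beta t.1.1).
  by rewrite /zd !mulpX.
have zn01 t : 0 <= zn t < 1 by rewrite znE; case: ifP => _; apply: fracpart_itv.
have zd01 t : 0 <= zd t < 1 by rewrite zdE; case: ifP => _; apply: fracpart_itv.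
have Wzn t : (p ^ N - 1)%:R * zn t \is a Num.int.
  by rewrite znE; case: ifP => _; apply: WF; apply: W_int; rewrite ?WN.
have Wzd t : (p ^ N - 1)%:R * zd t \is a Num.int.
  by rewrite zdE; case: ifP => _; apply: WF; rewrite ?WN.
have sumE (f : (I * 'I_r) * bool -> rat) :
    \sum_t f t = \sum_i \sum_k (f ((i, k), true) + f ((i, k), false)).
  rewrite pair_bigA /=.
  have -> : \sum_t f t = \sum_ik \sum_(b : bool) f (ik, b).
    by rewrite pair_bigA; apply: eq_bigr => -[].
  by apply: eq_bigr => -[i k] _; rewrite big_bool.
have int z : (p ^ N - 1)%:R * z \is a Num.int -> padic_integral p z.
  apply: padic_integral_intr.
  by rewrite -(coprime_pexpl _ _ N_gt0) subn1 coprimenP ?p_gt0.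
have gam_nE z : (p ^ N - 1)%:R * z \is a Num.int ->
    \prod_(h < n) gam ((z + h%:R) / n%:R)
    = tofrac (gamma_prod (@padic_gamma p p_pr) n (ratr z)).
  move=> /int z_int; rewrite rmorph_prod; apply: eq_bigr => h _.
  by rewrite /gamma_rat ratr_shift_div.
have prodE (z z' : (I * 'I_r) * bool -> rat) :
    (forall t, (p ^ N - 1)%:R * z t \is a Num.int) ->
    \prod_t ((\prod_(h < n) gam ((z t + h%:R) / n%:R)) * gam (z' t))
    = tofrac (\prod_t (gamma_prod (@padic_gamma p p_pr) n (ratr (z t))
                        * padic_gamma (ratr (z' t)))).
  move=> Wz; rewrite rmorph_prod; apply: eq_bigr => t _.
  by rewrite gam_nE // -rmorphM.
rewrite !prodE //; congr tofrac.
apply: (gamma_prod_ratio G_spec co_pn n_gt0 N_gt0) => //.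
- rewrite sumE; under eq_bigr do under eq_bigr do rewrite !znE !zdE /=.
  exact: sum_int.
rewrite !sumE; under eq_bigr do under eq_bigr do rewrite !znE !zdE /=.
under [RHS]eq_bigr do under eq_bigr do rewrite !znE !zdE /=.
exact: sum_pred.
Qed.

End GammaRat.

Theorem theorem2p8 (R : realType) (p : nat) (p_pr : prime p) (p_odd : odd p)
    (r : nat) (F : finFieldType) (cardF : #|F| = (p ^ r)%N)
    (L : fieldExtType ('Qp p_pr)) (res : L -> F)
    (resP : unramified_residue res)
    (n : nat) (n_gt0 : (0 < n)%N) (q_mod_n : (p ^ r = 1 %[mod n])%N)
    (zeta : F) (zetaP : n.-primitive_root zeta) (lambda : F)
    (m : nat) (m_gt0 : (0 < m)%N) (a b : 'I_m -> rat)
    (a_int : forall i, padic_integral p (a i))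
    (b_int : forall i, padic_integral p (b i)) :
  let na (i : 'I_m) : rat := n%:R * a i in
  let nb (i : 'I_m) : rat := n%:R * b i in
  let a_shift (il : 'I_m * 'I_n) : rat := a il.1 + il.2%:R / n%:R in
  let b_shift (il : 'I_m * 'I_n) : rat := b il.1 + il.2%:R / n%:R in
  (defined_over_Q R na nb ->
     \sum_(l < n) mGm res na nb r (zeta ^+ l * lambda)
     = mGm res a_shift b_shift r (lambda ^+ n))
  /\
  (forall P Q : seq nat, defined_over_Q_with R na nb P Q ->
     defined_over_Q_with R a_shift b_shift (map (muln n) P) (map (muln n) Q)).
Proof.
move=> na nb a_shift b_shift; split; last first.
  by move=> P Q; apply: defined_over_Q_with_shift.
move=> def_Q; have r_gt0 := card_expn_gt0 cardF.
have q_gt1 : (1 < p ^ r)%N by rewrite -cardF finRing_gt1.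
have q_gt0 := ltnW q_gt1.
(* A power of p with positive exponent is 1 modulo n. *)
have co_pn : coprime p n.
  by rewrite -(coprime_pexpl _ _ r_gt0) -coprime_modl q_mod_n coprime_modl coprime1n.
have /dvdnP[N qE] : (n %| p ^ r - 1)%N by rewrite -eqn_mod_dvd //; apply/eqP.
have n_int x : padic_integral p x -> padic_integral p (n%:R * x).
  by move=> x_int; apply: padic_integralM => //; apply/padic_integral_int/natr_int.
pose w : 'Qp p_pr := - p%:R.
have w_neq0 : w != 0.
  rewrite oppr_eq0 -(rmorph_nat (@tofrac (padic_int p_pr))) tofrac_eq0.
  by rewrite padic_natr_eq0 -lt0n prime_gt0.
pose C (I : finType) (u v : I -> rat) j := mGm_coeff p r (gamma_rat p_pr) w u v j.
have C_shift j : C _ a_shift b_shift j = C _ na nb (n * j)%N.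
  (* If some function meets the specification, the one chosen by [padic_gamma] does. *)
  have [[g gP]|no_gamma] := pselect (exists g, @morita_gamma_spec p p_pr g).
    apply: mGm_coeff_shift => //; apply: gamma_cross_ratio def_Q => //.
    - by apply: xgetI gP.
    - by move=> i; apply: n_int.
    - by move=> i; apply: n_int.
    rewrite mulrC divfK ?natr_int //.
    by rewrite pnatr_eq0 subn_eq0 -ltnNge.
  (* Otherwise Gamma_p is the junk value 0, and both coefficients vanish. *)
  have gam0 x : gamma_rat p_pr x = 0.
    rewrite /gamma_rat /padic_gamma xgetPN ?tofrac0 // => g gP.
    by apply: no_gamma; exists g.
  have J0 := (Ordinal m_gt0, Ordinal n_gt0).
  rewrite /C (mGm_coeff0 p w r_gt0 _ _ _ J0) //.
  by rewrite (mGm_coeff0 p w r_gt0 _ _ _ (Ordinal m_gt0)).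
have mGmE (I : finType) (u v : I -> rat) x : mGm res u v r x
    = ((- 1) / (p ^ r - 1)%:R : 'Qp p_pr) *: \sum_(j < (p ^ r).-1)
        C I u v j *: teichmuller_bar_exp res j x by [].
under eq_bigr do rewrite mGmE; rewrite mGmE -scaler_sumr; congr (_ *: _).
rewrite exchange_big /=.
pose f j := C _ na nb j *: teichmuller_bar_exp res j lambda.
(* Orthogonality leaves n times the terms whose index is a multiple of n. *)
transitivity (\sum_(j < (p ^ r).-1) (if (n %| j)%N then f j *+ n else 0)).
  apply: eq_bigr => j _; rewrite -scaler_sumr (teichmuller_bar_sum cardF) //.
  by case: ifP => _; rewrite ?scaler0 // mulr_natl scalerMnr.
transitivity (\sum_(j < (p ^ r).-1) f (n * j)%N); last first.
  apply: eq_bigr => j _.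
  by rewrite C_shift (teichmuller_bar_power cardF) //.
have -> : (p ^ r).-1 = (n * N)%N by rewrite mulnC -qE subn1.
rewrite (sum_multiples (fun j => f j *+ n)) // sumrMnl.
(* The right side runs over n periods of length N = (q - 1)/n, which accounts for the factor n on
   the left. *)
rewrite (@sum_periodic_mul _ f n N n) // => j.
have -> : (n * N = p ^ r - 1)%N by rewrite mulnC qE.
rewrite /f /C mGm_coeff_periodic //; congr (_ *: _).
by rewrite subn1 -cardF (teichmuller_bar_periodic cardF).
Qed.
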